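(* Let $m,a\ge0$ and $\ell\ge1$ be integers, and let $\mathcal{C}^0_\ell(m,a)$ be the arrangement in $\mathbb{R}^\ell$ consisting of the hyperplanes $x_i+x_j=s$ and $x_i-x_j=s$ for $1\le i<j\le\ell$ and integers $-a\le s\le a$, and $2x_i=s$ for $1\le i\le\ell$ and integers $-m\le s\le m$. Then the cone $\mathbf{c}\mathcal{C}^0_\ell(m,a)$ is flag-accurate. In particular, the extended Catalan arrangement $\mathrm{Cat}^m(C_\ell)=\mathcal{C}^0_\ell(m,m)$ of type $C_\ell$ has flag-accurate cone with exponents $(1,\ 2m\ell+2i-1)_{i=1}^{\ell}$.
   Context: For an affine arrangement $\mathcal{A}$ in $\mathbb{R}^\ell$, its cone $\mathbf{c}\mathcal{A}$ is the central arrangement in $V'=\mathbb{R}^{\ell+1}$ (extra coordinate $z$) consisting of the hyperplanes $a_1x_1+\dots+a_\ell x_\ell=dz$ for each hyperplane $a_1x_1+\dots+a_\ell x_\ell=d$ of $\mathcal{A}$, together with $z=0$. For a central arrangement $\mathcal{A}$ in $W=\mathbb{R}^n$: $L(\mathcal{A})$ is the set of intersections of subsets of $\mathcal{A}$ (including $W$); $\mathcal{A}^X=\{H\cap X:H\in\mathcal{A},X\not\subseteq H\}$; $\mathcal{A}$ is free if $D(\mathcal{A})=\{\theta\in\mathrm{Der}(S):\theta(\alpha_H)\in\alpha_HS\ \forall H\}$ is free over $S=\mathbb{R}[x_1,\dots,x_n]$, exponents being degrees of a homogeneous basis. $\mathcal{A}$ is flag-accurate if it is free with exponents $e_1\le\dots\le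 e_n$ and there is a flag $X_1\subseteq\dots\subseteq X_n=W$ in $L(\mathcal{A})$ with $\dim X_d=d$ and $\mathcal{A}^{X_d}$ free with exponents $(e_1,\dots,e_d)$ for all $d$. *)

(* Defs.v *)
From HB Require Import structures.
From mathcomp Require Import all_boot all_order all_algebra.
From mathcomp Require Import reals.
From mathcomp Require Import mpoly.

Set Implicit Arguments.
Unset Strict Implicit.
Unset Printing Implicit Defensive.

Import Order.TTheory GRing.Theory Num.Theory.
Local Open Scope ring_scope.

Section Arrangements.
Variable R : realType.

(* A central arrangement in R^n is the finite set of the subspaces listed in a
   sequence; order and repetitions play no role in what follows. *)
Definition arrangement (n : nat) : Type := seq {vspace 'rV[R]_n}.

Definition is_derivation (n : nat) (theta : {mpoly R[n]} -> {mpoly R[n]}) :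
    Prop :=
  linear theta /\
  forall p q, theta (p * q) = theta p * q + p * theta q.

(* alpha is a linear form with kernel H, i.e. a choice of alpha_H; such a form
   is unique up to a nonzero scalar. *)
Definition defining_form (n : nat) (H : {vspace 'rV[R]_n})
    (alpha : {mpoly R[n]}) : Prop :=
  alpha \is 1.-homog /\
  forall v : 'rV[R]_n, (v \in H) = (alpha.@[v 0] == 0).

(* The module D(A). *)
Definition log_derivation (n : nat) (A : arrangement n)
    (theta : {mpoly R[n]} -> {mpoly R[n]}) : Prop :=
  is_derivation theta /\
  forall H alpha, H \in A -> defining_form H alpha ->
    exists q, theta alpha = alpha * q.

(* Polynomial degree: the coefficients theta(x_i) of
   theta = \sum_i theta(x_i) d/dx_i are homogeneous of degree k. *)
Definition homog_derivation (n : nat) (k : nat)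
    (theta : {mpoly R[n]} -> {mpoly R[n]}) : Prop :=
  forall i : 'I_n, theta 'X_i \is k.-homog.

Definition free_with_exponents (n : nat) (A : arrangement n) (e : seq nat) :
    Prop :=
  exists theta : 'I_(size e) -> {mpoly R[n]} -> {mpoly R[n]},
    [/\ forall i : 'I_(size e), log_derivation A (theta i),
        forall i : 'I_(size e), homog_derivation (nth 0%N e i) (theta i)
      & forall eta, log_derivation A eta ->
          exists! c : {ffun 'I_(size e) -> {mpoly R[n]}},
            forall p, eta p = \sum_i c i * theta i p].

Definition in_lattice (n : nat) (A : arrangement n) (X : {vspace 'rV[R]_n}) :
    Prop :=
  exists2 B : arrangement n, {subset B <= A} & X = (\bigcap_(H <- B) H)%VS.

(* A^X, as a set of subspaces of X. *)
Definition restriction (n : nat) (A : arrangement n) (X : {vspace 'rV[R]_n}) :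
    arrangement n :=
  [seq (H :&: X)%VS | H <- A & ~~ (X <= H)%VS].

(* Freeness of an arrangement B in the vector space X (all members of B are
   contained in X), read in linear coordinates f : R^d ~ X.  The choice of f is
   immaterial, a linear change of coordinates preserving freeness and degrees. *)
Definition free_with_exponents_in (n : nat) (X : {vspace 'rV[R]_n})
    (B : arrangement n) (e : seq nat) : Prop :=
  exists f : 'Hom('rV[R]_(\dim X), 'rV[R]_n),
    [/\ lker f = 0%VS, limg f = X
      & free_with_exponents [seq (f @^-1: K)%VS | K <- B] e].

Definition flag_accurate_with_exponents (n : nat) (A : arrangement n)
    (e : seq nat) : Prop :=
  [/\ size e = n, sorted leq e, free_with_exponents A e
    & exists X : nat -> {vspace 'rV[R]_n},
        [/\ forall d, (1 <= d <= n)%N -> in_lattice A (X d) /\ \dim (X d) = d,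
            forall d, (1 <= d < n)%N -> (X d <= X d.+1)%VS,
            X n = fullv
          & forall d, (1 <= d <= n)%N ->
              free_with_exponents_in (X d) (restriction A (X d)) (take d e)]].

Definition flag_accurate (n : nat) (A : arrangement n) : Prop :=
  exists e : seq nat, flag_accurate_with_exponents A e.

(* The pair (b, d) stands for the affine hyperplane
   b_1 x_1 + ... + b_l x_l = d of R^l. *)
Definition affine_arrangement (l : nat) : Type := seq ('rV[R]_l * R).

Definition linear_hyperplane (n : nat) (b : 'rV[R]_n) : {vspace 'rV[R]_n} :=
  lker (linfun (mulmxr b^T : 'rV[R]_n -> 'rV[R]_1)).

(* The extra coordinate z is the last one of R^(l + 1). *)
Definition cone (l : nat) (A : affine_arrangement l) : arrangement (l + 1)%N :=
  linear_hyperplane (row_mx 0 1%:M)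
    :: [seq linear_hyperplane (row_mx h.1 (- h.2)%:M) | h <- A].

(* The integers -k, ..., k, in R. *)
Definition int_range (k : nat) : seq R :=
  [seq j%:R - k%:R | j <- iota 0 (2 * k + 1)%N].

Definition ord_pairs (l : nat) : seq ('I_l * 'I_l) :=
  [seq p : 'I_l * 'I_l <- enum {: 'I_l * 'I_l} | (p.1 < p.2)%N].

Definition x_ (l : nat) (i : 'I_l) : 'rV[R]_l := delta_mx 0 i.

Definition C0 (l m a : nat) : affine_arrangement l :=
  [seq (x_ p.1 + x_ p.2, s) | p <- ord_pairs l, s <- int_range a] ++
  [seq (x_ p.1 - x_ p.2, s) | p <- ord_pairs l, s <- int_range a] ++
  [seq (2 *: x_ i, s) | i <- enum 'I_l, s <- int_range m].

(* The positive roots of C_l, as linear forms on R^l. *)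
Definition posroots_C (l : nat) : seq 'rV[R]_l :=
  [seq x_ p.1 + x_ p.2 | p <- ord_pairs l] ++
  [seq x_ p.1 - x_ p.2 | p <- ord_pairs l] ++
  [seq 2 *: x_ i | i <- enum 'I_l].

Definition CatC (l m : nat) : affine_arrangement l :=
  [seq (b, s) | b <- posroots_C l, s <- int_range m].

End Arrangements.

(* Main.v *)
Require Import Defs.
From HB Require Import structures.
From mathcomp Require Import all_boot all_order all_algebra.
From mathcomp Require Import reals.
From mathcomp Require Import mpoly.
From mathcomp Require Import ring lra zify.

(* Write h = z / 2. The fields of the cone that kill z are taken in the form
   sum_i F(x_i) d/dx_i with F a single odd polynomial in t whose coefficients
   are polynomials in x and z. Such a field is tangent to all hyperplanes as
   soon as F(w') = F(w) whenever w and w' = w + 2 s h are among the +-x_i, with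
   |s| <= a if they have different indices and |s| <= m if w' = -w. Let
     H_k(v) = prod_(r < m + k) (v - ((a - r) h)^2)
              * prod_(i, c) (v - (x_i + c h)^2),   c = 1 - a, 3 - a, ..., a - 1,
   a polynomial in v = t^2, and let F_k be the odd solution of
     F_k(t + h) - F_k(t - h) = 2 h (D^a H_k)(t),
     (D f)(t) = (f(t + h) - f(t - h)) / (4 h t).
   Then F_k(w') - F_k(w) is a sum of values of D^a H_k, and such a value is,
   up to the factor a!, a divided difference of H_k at a + 1 of its roots.
   Expanding H_k in the Newton basis on which D acts by lowering the index makes
   F_k explicit, homogeneous of degree 2 (a (l - 1) + m + k) + 1.

   The Euler field and F_0, ..., F_(l-1) form a basis by the criterion of
   Saito. At z = 0 the independence reduces, by taking the leading term in one
   variable after the other, to the nonvanishing of iterated differences of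
   n (n - 1) ... (n - a + 1) / (2 (n - a) + 1). The same argument applies on
   the flats where the first variables form a string x_i - x_(i+1) = - a z: the
   Euler field and the first fields F_k restrict to a basis there, and these
   flats form the flag. *)

Set Implicit Arguments.
Unset Strict Implicit.
Unset Printing Implicit Defensive.

Import Order.TTheory GRing.Theory Num.Theory.
Local Open Scope ring_scope.

(** * Divided differences on a quadratic lattice *)

Section NewtonForm.
Variable S : comNzRingType.
Implicit Types (A base : nat -> S) (cs : seq S) (n b : nat) (c h s t : S).

(* The linear form on polynomials in v that takes the Newton polynomials psi_n,
   with psi_(n+1) = (v - A n) psi_n, to [base n], evaluated at
   psi_n * prod_(c <- cs) (v - c). *)
Fixpoint newton A base cs n : S :=
  if cs is c :: cs' then newton A base cs' n.+1 + (A n - c) * newton A base cs' n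
  else base n.

Lemma newton_perm A base cs cs' n :
  perm_eq cs cs' -> newton A base cs n = newton A base cs' n.
Proof.
have swap c d ds m :
    newton A base (c :: d :: ds) m = newton A base (d :: c :: ds) m.
  by rewrite /=; ring.
have move_front c cs1 cs2 m :
    newton A base (cs1 ++ c :: cs2) m = newton A base (c :: cs1 ++ cs2) m.
  elim: cs1 m => // d cs1 IH m.
  by rewrite -swap /= !IH.
elim: cs cs' n => [|c cs IH] cs' n.
  by rewrite perm_sym => /perm_nilP ->.
move=> eq_cs; have c_in : c \in cs' by rewrite -(perm_mem eq_cs) mem_head.
case/splitPr: c_in eq_cs => cs1 cs2 eq_cs; rewrite move_front /=.
have eq_s : perm_eq cs (cs1 ++ cs2).
  rewrite -(perm_cons c); apply: perm_trans eq_cs _.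
  by rewrite perm_catC /= perm_cons perm_catC.
by rewrite !(IH _ _ eq_s).
Qed.

Lemma eq_newton A A' base base' cs n :
  A =1 A' -> base =1 base' -> newton A base cs n = newton A' base' cs n.
Proof.
by move=> eqA eqb; elim: cs n => [|c cs IH] n /=; rewrite ?eqb // !IH eqA.
Qed.

Lemma newtonZ A base c cs n :
  newton A (fun m => c * base m) cs n = c * newton A base cs n.
Proof. by elim: cs n => [|d cs IH] n //=; rewrite !IH; ring. Qed.

Lemma newtonB A base base' cs n :
  newton A (fun m => base m - base' m) cs n =
  newton A base cs n - newton A base' cs n.
Proof. by elim: cs n => [|d cs IH] n //=; rewrite !IH; ring. Qed.

Definition snode s h n : S := (s + (2 * n)%:R * h) ^+ 2.

Definition snodes s h n : seq S := [seq snode s h j | j <- iota 0 n].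

Lemma snodesD s h m n :
  snodes s h (m + n) = snodes s h m ++ snodes (s + (2 * m)%:R * h) h n.
Proof.
rewrite /snodes iotaD add0n map_cat; congr (_ ++ _).
rewrite -[X in iota X _]addn0 iotaDl -map_comp; apply: eq_map => j /=.
by rewrite /snode mulnDr natrD; congr (_ ^+ 2); ring.
Qed.

Definition fprod s h n t : S := \prod_(j < n) (t ^+ 2 - snode s h j).

Lemma fprod_even s h n t : fprod s h n (- t) = fprod s h n t.
Proof. by rewrite /fprod sqrrN. Qed.

Lemma fprodE s h n t :
  fprod s h n t =
  (\prod_(j < n) (t + s + (2 * j)%:R * h)) *
  (\prod_(j < n) (t - s - (2 * j)%:R * h)).
Proof.
by rewrite /fprod -big_split; apply: eq_bigr => j _; rewrite /snode /=; ring.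
Qed.

Lemma fprod_diff s h n t :
  fprod s h n.+1 (t + h) - fprod s h n.+1 (t - h) =
  4 * h * t * n.+1%:R * fprod (s + h) h n t.
Proof.
rewrite !fprodE.
rewrite [X in X * _ - _]big_ord_recr [X in _ * X - _]big_ord_recl /=.
rewrite [X in _ - X * _]big_ord_recl [X in _ - _ * X]big_ord_recr /=.
have e1 : \prod_(i < n) (t + h + s + (2 * i)%:R * h) =
          \prod_(i < n) (t + (s + h) + (2 * i)%:R * h).
  by apply: eq_bigr => i _; ring.
have e2 : \prod_(i < n) (t + h - s - (2 * bump 0 i)%:R * h) =
          \prod_(i < n) (t - (s + h) - (2 * i)%:R * h).
  by apply: eq_bigr => i _; rewrite /bump /= mulnDr natrD; ring.
have e3 : \prod_(i < n) (t - h + s + (2 * bump 0 i)%:R * h) =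
          \prod_(i < n) (t + (s + h) + (2 * i)%:R * h).
  by apply: eq_bigr => i _; rewrite /bump /= mulnDr natrD; ring.
have e4 : \prod_(i < n) (t - h - s - (2 * i)%:R * h) =
          \prod_(i < n) (t - (s + h) - (2 * i)%:R * h).
  by apply: eq_bigr => i _; ring.
rewrite e1 e2 e3 e4 muln0 natrM -natr1; ring.
Qed.

Lemma fprod_odd_diff h n t :
  (t + h) * fprod (2 * h) h n (t + h) - (t - h) * fprod (2 * h) h n (t - h) =
  2 * h * (2 * n + 1)%:R * fprod h h n t.
Proof.
rewrite !fprodE.
set P := \prod_(j < n) (t + h + (2 * j)%:R * h).
set M := \prod_(j < n) (t - h - (2 * j)%:R * h).
have eP : (t + h) * \prod_(j < n) (t + h + 2 * h + (2 * j)%:R * h) =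
          P * (t + h + (2 * n)%:R * h).
  transitivity (\prod_(j < n.+1) (t + h + (2 * j)%:R * h)).
    rewrite big_ord_recl /= muln0 mul0r addr0; congr (_ * _).
    by apply: eq_bigr => i _; rewrite /bump /= mulnDr natrD; ring.
  by rewrite big_ord_recr.
have eM : (t - h) * \prod_(j < n) (t - h - 2 * h - (2 * j)%:R * h) =
          M * (t - h - (2 * n)%:R * h).
  transitivity (\prod_(j < n.+1) (t - h - (2 * j)%:R * h)).
    rewrite big_ord_recl /= muln0 mul0r subr0; congr (_ * _).
    by apply: eq_bigr => i _; rewrite /bump /= mulnDr natrD; ring.
  by rewrite big_ord_recr.
have eP' : \prod_(j < n) (t - h + 2 * h + (2 * j)%:R * h) = P.
  by apply: eq_bigr => i _; ring.
have eM' : \prod_(j < n) (t + h - 2 * h - (2 * j)%:R * h) = M.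
  by apply: eq_bigr => i _; ring.
rewrite eP' eM' mulrA eP [X in _ - X]mulrCA eM natrD natrM; ring.
Qed.

(* The value at t of D^b (psi_n * prod_(c <- cs) (t^2 - c)), where
   (D f)(t) = (f (t + h) - f (t - h)) / (4 h t): by [fprod_diff], D maps
   [fprod s h n.+1] to [n.+1%:R * fprod (s + h) h n]. *)
Definition divdiff s h b cs n t : S :=
  newton (snode s h)
    (fun m => (m ^_ b)%:R * fprod (s + b%:R * h) h (m - b) t) cs n.

Lemma divdiff_even s h b cs n t :
  divdiff s h b cs n (- t) = divdiff s h b cs n t.
Proof. by apply: eq_newton => // m; rewrite fprod_even. Qed.

Lemma divdiff0 s h cs n t :
  divdiff s h 0 cs n t = fprod s h n t * \prod_(c <- cs) (t ^+ 2 - c).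
Proof.
elim: cs n => [|c cs IH] n.
  by rewrite big_nil /divdiff /= ffactn0 mul1r mul0r addr0 mulr1 subn0.
have := IH n; have := IH n.+1.
rewrite /divdiff /= big_cons => -> ->.
by rewrite /fprod big_ord_recr /=; ring.
Qed.

Lemma divdiffS s h b cs n t :
  4 * h * t * divdiff s h b.+1 cs n t =
  divdiff s h b cs n (t + h) - divdiff s h b cs n (t - h).
Proof.
rewrite /divdiff -newtonZ -newtonB; apply: eq_newton => // m.
have [lt_mb|le_bm] := ltnP b m; last first.
  rewrite ffact_small ?ltnS // mul0r mulr0.
  have -> : (m - b = 0)%N by apply/eqP; rewrite subn_eq0.
  by rewrite /fprod !big_ord0 subrr.
rewrite -mulrBr -(subnSK lt_mb) fprod_diff ffactnSr natrM subnSK //.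
have -> : s + b.+1%:R * h = s + b%:R * h + h by rewrite -natr1; ring.
by ring.
Qed.

(* The odd solution of F (t + h) - F (t - h) = 2 h divdiff, see [antidiff_diff]. *)
Definition antidiff (g : nat -> S) a h cs n t : S :=
  newton (snode ((1 - a%:R) * h) h)
    (fun m => g m * (t * fprod (2 * h) h (m - a) t)) cs n.

Lemma antidiff_odd g a h cs n t :
  antidiff g a h cs n (- t) = - antidiff g a h cs n t.
Proof.
rewrite -[RHS]mulN1r /antidiff -newtonZ; apply: eq_newton => // m.
by rewrite fprod_even; ring.
Qed.

Lemma antidiff_diff g a h cs n t :
  (forall m, g m * (2 * (m - a) + 1)%:R = (m ^_ a)%:R) ->
  antidiff g a h cs n (t + h) - antidiff g a h cs n (t - h) =
  2 * h * divdiff ((1 - a%:R) * h) h a cs n t.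
Proof.
move=> gP; rewrite /antidiff /divdiff -newtonB -newtonZ; apply: eq_newton => // m.
rewrite -mulrBr fprod_odd_diff -gP.
have -> : (1 - a%:R) * h + a%:R * h = h by ring.
by ring.
Qed.

End NewtonForm.

Section NewtonMorphism.
Variables (S S' : comNzRingType) (f : {rmorphism S -> S'}).

Lemma rmorph_newton A base cs n :
  f (newton A base cs n) = newton (f \o A) (f \o base) (map f cs) n.
Proof.
by elim: cs n => [|c cs IH] n //=; rewrite rmorphD rmorphM rmorphB !IH.
Qed.

Lemma rmorph_snode s h n : f (snode s h n) = snode (f s) (f h) n.
Proof. by rewrite /snode rmorphXn rmorphD rmorphM rmorph_nat. Qed.

Lemma rmorph_snodes s h n : map f (snodes s h n) = snodes (f s) (f h) n.
Proof. by rewrite -map_comp; apply: eq_map => j /=; rewrite rmorph_snode. Qed.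

Lemma rmorph_fprod s h n t : f (fprod s h n t) = fprod (f s) (f h) n (f t).
Proof.
rewrite rmorph_prod; apply: eq_bigr => j _.
by rewrite rmorphB rmorphXn rmorph_snode.
Qed.

Lemma rmorph_divdiff s h b cs n t :
  f (divdiff s h b cs n t) = divdiff (f s) (f h) b (map f cs) n (f t).
Proof.
rewrite rmorph_newton; apply: eq_newton => m /=.
  by rewrite rmorph_snode.
by rewrite rmorphM rmorph_fprod rmorphD rmorphM !rmorph_nat.
Qed.

Lemma rmorph_antidiff g a h cs n t :
  f (antidiff g a h cs n t) = antidiff (f \o g) a (f h) (map f cs) n (f t).
Proof.
rewrite rmorph_newton; apply: eq_newton => m /=.
  by rewrite rmorph_snode rmorphM rmorphB rmorph1 rmorph_nat.
by rewrite !rmorphM rmorph_fprod rmorphM rmorph_nat.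
Qed.

End NewtonMorphism.

Section DivDiffVanishing.
Variable K : numDomainType.

(* Divided differences are computed at the generic point 'X, where the
   recursion [divdiffS] determines them; the nodes may collide afterwards. *)
Lemma divdiff_generic_eq0 (s h d : K) b (cs : seq {poly K}) n : h != 0 ->
  divdiff s%:P h%:P b
    (snodes ('X + d%:P - b%:R * h%:P) h%:P b.+1 ++ cs) n ('X + d%:P) = 0.
Proof.
move=> h_neq0; elim: b d cs => [|b IH] d cs.
  rewrite divdiff0 big_cat /= /snodes /= big_seq1 /snode /=.
  by rewrite !mul0r subr0 addr0 subrr mul0r mulr0.
have X_neq0 : 'X + d%:P != 0 :> {poly K}.
  by rewrite -size_poly_eq0 size_XaddC.
have h4_neq0 : 4 * h%:P != 0 :> {poly K}.
  by rewrite mulf_neq0 ?polyC_eq0 // -polyC_natr polyC_eq0 pnatr_eq0.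
apply/eqP; rewrite -(mulrI_eq0 _ (mulfI (mulf_neq0 h4_neq0 X_neq0))) divdiffS.
have -> : 'X + d%:P + h%:P = 'X + (d + h)%:P by rewrite polyCD addrA.
have -> : 'X + d%:P - h%:P = 'X + (d - h)%:P by rewrite polyCB addrA.
set t0 := 'X + d%:P - _.
have first_node : snodes t0 h%:P b.+2 = snodes t0 h%:P 1 ++
    snodes ('X + (d + h)%:P - b%:R * h%:P) h%:P b.+1.
  rewrite -[b.+2]add1n snodesD; congr (_ ++ snodes _ _ _).
  by rewrite /t0 polyCD -natr1; ring.
have last_node : snodes t0 h%:P b.+2 =
    snodes ('X + (d - h)%:P - b%:R * h%:P) h%:P b.+1 ++
    snodes (t0 + (2 * b.+1)%:R * h%:P) h%:P 1.
  rewrite -[b.+2]addn1 snodesD; congr (snodes _ _ _ ++ _).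
  by rewrite /t0 polyCB -natr1; ring.
rewrite {2}last_node -catA IH subr0 first_node.
rewrite /divdiff -catA (newton_perm _ _ _ (permEl (perm_catCA _ _ _))).
by apply/eqP; exact: IH.
Qed.

Lemma divdiff_eq0 (s h t : K) b cs rest n : h != 0 ->
  perm_eq cs (snodes (t - b%:R * h) h b.+1 ++ rest) ->
  divdiff s h b cs n t = 0.
Proof.
move=> h_neq0 eq_cs; rewrite /divdiff (newton_perm _ _ _ eq_cs).
have := @divdiff_generic_eq0 s h 0 b (map polyC rest) n h_neq0.
move/(congr1 (horner_eval t)).
rewrite (rmorph_divdiff (horner_eval t)) rmorph0 map_cat rmorph_snodes.
rewrite -map_comp.
have -> : map (horner_eval t \o polyC) rest = rest.
  by rewrite -[RHS]map_id; apply: eq_map => c /=; rewrite /horner_eval hornerC.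
by rewrite /= /horner_eval !hornerE -polyC_natr hornerC.
Qed.

End DivDiffVanishing.

(** * Tangency to the affine hyperplanes *)

Section SquaredRoots.
Variable S : comNzRingType.

Definition central_squares (a : nat) (h : S) k : seq S :=
  [seq ((a%:R - r%:R) * h) ^+ 2 | r <- iota 0 k].

(* The squares (y + c h)^2 for c = 1 - a, 3 - a, ..., a - 1. *)
Definition shifted_squares (a : nat) (h y : S) : seq S :=
  snodes (y + (1 - a%:R) * h) h a.

Definition squares l a h k (x : 'I_l -> S) : seq S :=
  central_squares a h k ++ flatten [seq shifted_squares a h (x j) | j <- enum 'I_l].

Definition field_value g l a h k (x : 'I_l -> S) (t : S) : S :=
  antidiff g a h (squares a h k x) 0 t.

Lemma mulr2n_split (h : S) m n :
  (m <= n)%N -> (2 * n)%:R * h = (2 * m)%:R * h + (2 * (n - m))%:R * h.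
Proof. by move=> le_mn; rewrite -mulrDl -natrD -mulnDr subnKC. Qed.

Lemma shifted_squaresN a h y :
  perm_eq (shifted_squares a h (- y)) (shifted_squares a h y).
Proof.
rewrite -perm_rev; apply/permP => P; congr (count P _).
apply: (@eq_from_nth _ 0) => [|j]; rewrite size_rev !size_map // size_iota.
move=> lt_ja; rewrite nth_rev ?size_map ?size_iota //.
have lt_ja' : (a - j.+1 < a)%N by lia.
rewrite !(nth_map 0%N) ?size_iota // !nth_iota // !add0n /snode.
by rewrite mulnBr natrB ?leq_mul2l // !natrM -natr1; ring.
Qed.

Lemma squares_perm2 l a h k (x : 'I_l -> S) i j : i != j ->
  exists rest, perm_eq (squares a h k x)
    (shifted_squares a h (x i) ++ shifted_squares a h (x j) ++ rest).
Proof.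
move=> neq_ij; pose F j := shifted_squares a h (x j).
exists (flatten (map F (rem j (rem i (enum 'I_l)))) ++ central_squares a h k).
rewrite /squares perm_catC !catA perm_cat2r -catA.
have perm1 : perm_eq (enum 'I_l) [:: i, j & rem j (rem i (enum 'I_l))].
  apply: perm_trans (perm_to_rem (mem_enum _ i)) _.
  rewrite perm_cons perm_to_rem // mem_rem_uniq ?enum_uniq //.
  by rewrite !inE eq_sym neq_ij mem_enum.
exact: perm_flatten (perm_map F perm1).
Qed.

Lemma squares_perm1 l a h k (x : 'I_l -> S) i :
  exists rest, perm_eq (squares a h k x)
    (central_squares a h k ++ shifted_squares a h (x i) ++ rest).
Proof.
pose F j := shifted_squares a h (x j).
exists (flatten (map F (rem i (enum 'I_l)))); rewrite perm_cat2l.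
exact: perm_flatten (perm_map F (perm_to_rem (mem_enum _ i))).
Qed.

End SquaredRoots.

Lemma perm_sub_uniq (T : eqType) (s1 s2 : seq T) :
  uniq s1 -> uniq s2 -> {subset s1 <= s2} ->
  perm_eq s2 (s1 ++ [seq x <- s2 | x \notin s1]).
Proof.
move=> u1 u2 s12; apply: uniq_perm => // [|x].
  rewrite cat_uniq u1 filter_uniq // andbT; apply/hasPn => x.
  by rewrite mem_filter => /andP[].
by rewrite mem_cat mem_filter; case: (boolP (x \in s1)) => //= /s12.
Qed.

Section Tangency.
Variables (K : numFieldType) (g : nat -> K) (a : nat).
Hypothesis gP : forall m, g m * (2 * (m - a) + 1)%:R = (m ^_ a)%:R.

Lemma antidiff_shift h (cs : seq K) w s :
  (forall n, (n < s)%N ->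
     divdiff ((1 - a%:R) * h) h a cs 0 (w + (2 * n + 1)%:R * h) = 0) ->
  antidiff g a h cs 0 (w + (2 * s)%:R * h) = antidiff g a h cs 0 w.
Proof.
elim: s => [|s IH] dd0; first by rewrite mul0r addr0.
rewrite -IH => [|n lt_ns]; last by rewrite dd0 // ltnS ltnW.
apply/eqP; rewrite -subr_eq0; apply/eqP.
have := antidiff_diff h cs 0 (w + (2 * s + 1)%:R * h) gP.
rewrite dd0 // mulr0 => <-.
by congr (antidiff _ _ _ _ _ _ - antidiff _ _ _ _ _ _); ring.
Qed.

Lemma field_value_shift2 l h k (x : 'I_l -> K) i j s w w' :
  i != j -> (s <= a)%N ->
  perm_eq (shifted_squares a h (x i)) (shifted_squares a h w) ->
  perm_eq (shifted_squares a h (x j)) (shifted_squares a h w') ->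
  w' = w + (2 * s)%:R * h ->
  field_value g a h k x w' = field_value g a h k x w.
Proof.
move=> neq_ij le_sa eq_w eq_w' def_w'.
have [h0|h_neq0] := eqVneq h 0; first by rewrite def_w' h0 mulr0 addr0.
rewrite {}def_w' in eq_w' *; rewrite /field_value antidiff_shift // => n lt_ns.
have [rest eq_sq] := squares_perm2 a h k x neq_ij.
set s0 := w + (1 - a%:R) * h.
have def_w : shifted_squares a h w =
    snodes s0 h n ++ snodes (s0 + (2 * n)%:R * h) h (a - n).
  by rewrite -snodesD subnKC //; lia.
have def_w' : shifted_squares a h (w + (2 * s)%:R * h) =
    snodes (s0 + (2 * s)%:R * h) h (a - s) ++
    (snodes (s0 + (2 * a)%:R * h) h n.+1 ++
     snodes (s0 + (2 * (a + n.+1))%:R * h) h (s - n.+1)).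
  have -> : snodes (s0 + (2 * (a + n.+1))%:R * h) h (s - n.+1) =
    snodes (s0 + (2 * a)%:R * h + (2 * n.+1)%:R * h) h (s - n.+1).
    by congr snodes; rewrite mulnDr natrD; ring.
  rewrite -snodesD subnKC //.
  have -> : snodes (s0 + (2 * a)%:R * h) h s =
    snodes (s0 + (2 * s)%:R * h + (2 * (a - s))%:R * h) h s.
    by congr snodes; rewrite (mulr2n_split _ le_sa) addrA.
  by rewrite -snodesD subnK // /shifted_squares addrAC.
apply: (@divdiff_eq0 _ _ _ _ _ _ (snodes s0 h n ++
  snodes (s0 + (2 * s)%:R * h) h (a - s) ++
  snodes (s0 + (2 * (a + n.+1))%:R * h) h (s - n.+1) ++ rest) _ h_neq0).
apply: perm_trans eq_sq _.
apply: perm_trans (perm_cat eq_w (perm_cat eq_w' (perm_refl _))) _.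
have -> : snodes (w + (2 * n + 1)%:R * h - a%:R * h) h a.+1 =
    snodes (s0 + (2 * n)%:R * h) h (a - n) ++ snodes (s0 + (2 * a)%:R * h) h n.+1.
  have -> : s0 + (2 * a)%:R * h = s0 + (2 * n)%:R * h + (2 * (a - n))%:R * h.
    by rewrite (@mulr2n_split _ h n a) ?addrA //; lia.
  rewrite -snodesD; congr snodes; last by lia.
  by rewrite /s0 !natrD; ring.
rewrite def_w def_w'.
set A1 := snodes s0 h n; set A2 := snodes _ _ (a - n).
set A3 := snodes _ _ (a - s); set A4 := snodes _ _ n.+1.
set A5 := snodes _ _ _.
apply/permP => P; rewrite !count_cat; lia.
Qed.

Lemma central_squares_sub (h : K) k r p : (r < k)%N -> (2 * p <= r.+2)%N ->
  exists rest, perm_eq (central_squares a h k)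
    ([seq ((a%:R - (r - 2 * j)%:R) * h) ^+ 2 | j <- iota 0 p] ++ rest).
Proof.
move=> lt_rk le_pr; pose s1 := [seq (r - 2 * j)%N | j <- iota 0 p].
have u1 : uniq s1.
  rewrite map_inj_in_uniq ?iota_uniq // => i j.
  by rewrite !mem_iota; lia.
have s12 : {subset s1 <= iota 0 k}.
  by move=> _ /mapP[j _ ->]; rewrite mem_iota; lia.
pose F r := ((a%:R - r%:R) * h) ^+ 2.
exists (map F [seq x <- iota 0 k | x \notin s1]).
have := perm_map F (perm_sub_uniq u1 (iota_uniq 0 k) s12).
by rewrite map_cat -map_comp.
Qed.

Lemma field_value_reflect l h k (x : 'I_l -> K) i s :
  (s <= k)%N ->
  perm_eq (shifted_squares a h (x i)) (shifted_squares a h (s%:R * h)) ->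
  field_value g a h k x (s%:R * h) = 0.
Proof.
move=> le_sk eq_xi.
suff eqV : field_value g a h k x (- (s%:R * h) + (2 * s)%:R * h) =
           field_value g a h k x (- (s%:R * h)).
  have e : - (s%:R * h) + (2 * s)%:R * h = s%:R * h by rewrite natrM; ring.
  move: eqV; rewrite e /field_value antidiff_odd => /eqP.
  by rewrite -addr_eq0 -mulr2n mulrn_eq0 => /orP[//|/eqP].
have [h0|h_neq0] := eqVneq h 0; first by rewrite h0 !mulr0 addr0.
rewrite /field_value antidiff_shift // => n lt_ns.
wlog le_2ns : n lt_ns / (2 * n < s)%N.
  move=> WL; have [lt_2ns|lt_s2n] := ltnP (2 * n) s; first exact: WL.
  rewrite -divdiff_even -(WL (s - n.+1)%N); [|lia|lia].
  congr divdiff; rewrite (natrD _ (2 * n)) (natrD _ (2 * (s - n.+1))).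
  by rewrite !natrM natrB // -natr1; ring.
have [rest eq_sq] := squares_perm1 a h k x i.
have eq_w : perm_eq (shifted_squares a h (x i)) (shifted_squares a h (- (s%:R * h))).
  by apply: perm_trans eq_xi _; rewrite perm_sym shifted_squaresN.
set s0 := - (s%:R * h) + (1 - a%:R) * h.
have eN : - (s%:R * h) + (2 * n + 1)%:R * h - a%:R * h = s0 + (2 * n)%:R * h.
  by rewrite /s0 natrD; ring.
pose n0 := maxn n a.
have le_n0 : (n <= n0 <= n + a)%N by lia.
have [rest' eq_c] : exists rest', perm_eq (central_squares a h k)
    (snodes (s0 + (2 * n0)%:R * h) h ((n + a).+1 - n0) ++ rest').
  have [||rest' eq_c] := @central_squares_sub h k (2 * a + s - (1 + 2 * n0))
      ((n + a).+1 - n0); [lia|lia|].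
  exists rest'; apply: perm_trans eq_c _; rewrite perm_cat2r.
  apply/permP => P; congr (count P _); apply/eq_in_map => j.
  rewrite mem_iota => lt_j; rewrite /snode /s0.
  rewrite -subnDA natrB; last by lia.
  by ring.
have [rest2 eq_s] : exists rest2, perm_eq (shifted_squares a h (- (s%:R * h)))
    (snodes (s0 + (2 * n)%:R * h) h (n0 - n) ++ rest2).
  have [lt_an|le_na] := ltnP a n.
    have -> : (n0 - n = 0)%N by lia.
    by exists (shifted_squares a h (- (s%:R * h))).
  exists (snodes s0 h n); rewrite perm_sym perm_catC.
  have -> : (n0 - n = a - n)%N by lia.
  by rewrite -snodesD subnKC.
apply: (@divdiff_eq0 _ _ _ _ _ _ (rest' ++ rest2 ++ rest) _ h_neq0).
apply: perm_trans eq_sq _.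
apply: perm_trans (perm_cat eq_c (perm_cat (perm_trans eq_w eq_s) (perm_refl _))) _.
rewrite eN.
have -> : a.+1 = (n0 - n + ((n + a).+1 - n0))%N by lia.
have eq_n0 : s0 + (2 * n0)%:R * h =
    s0 + (2 * n)%:R * h + (2 * (n0 - n))%:R * h.
  by rewrite (@mulr2n_split _ h n n0) ?addrA //; lia.
rewrite snodesD -eq_n0.
set A1 := snodes _ _ (n0 - n); set A2 := snodes _ _ (_ - n0).
by apply/permP => P; rewrite !count_cat; lia.
Qed.

End Tangency.

Lemma field_value_odd (S : comNzRingType) (g : nat -> S) l a h k (x : 'I_l -> S) t :
  field_value g a h k x (- t) = - field_value g a h k x t.
Proof. exact: antidiff_odd. Qed.

(** * Independence at z = 0 *)

Section FiniteDifferences.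
Variable S : comNzRingType.
Implicit Types (f : nat -> S) (n q : nat).

Definition fdiff f n : S := f n.+1 - f n.

Lemma eq_iter_fdiff f f' q : f =1 f' -> iter q fdiff f =1 iter q fdiff f'.
Proof. by move=> eqf; elim: q => [|q IH] n //=; rewrite /fdiff !IH. Qed.

Lemma iter_fdiffD f f' q n :
  iter q fdiff (fun m => f m + f' m) n = iter q fdiff f n + iter q fdiff f' n.
Proof.
by elim: q n => [|q IH] n //=; rewrite /fdiff !IH opprD addrACA.
Qed.

Lemma iter_fdiffZ c f q n :
  iter q fdiff (fun m => c * f m) n = c * iter q fdiff f n.
Proof. by elim: q n => [|q IH] n //=; rewrite /fdiff !IH mulrBr. Qed.

Lemma iter_fdiff_eq0 f q n :
  (forall m, (m <= n + q)%N -> f m = 0) -> iter q fdiff f n = 0.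
Proof.
elim: q n => [|q IH] n f0 /=; first by rewrite f0 ?addn0.
by rewrite /fdiff !IH ?subrr // => m le_m; apply: f0; lia.
Qed.

Lemma mul_ffact_subn n b :
  (n ^_ b)%:R * (n - b)%:R = (n ^_ b)%:R * (n%:R - b%:R) :> S.
Proof.
have [lt_nb|le_bn] := ltnP n b; first by rewrite ffact_small // !mul0r.
by rewrite natrB.
Qed.

Lemma iter_fdiff_ffact b q n :
  (b < q)%N -> iter q fdiff (fun m => (m ^_ b)%:R) n = 0.
Proof.
case: q => // q; rewrite ltnS iterSr; elim: b q n => [|b IH] q n le_bq.
  by rewrite iter_fdiff_eq0 // => m _; rewrite /fdiff !ffactn0 subrr.
rewrite (@eq_iter_fdiff _ (fun m => b.+1%:R * (m ^_ b)%:R)) => [|m].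
  by rewrite iter_fdiffZ; case: q le_bq => // q lt_bq; rewrite iterSr IH ?mulr0.
rewrite /fdiff ffactSS ffactnSr !natrM mul_ffact_subn -!natr1; ring.
Qed.

End FiniteDifferences.

Section Weights.
Variables (K : numFieldType) (a : nat).

Definition weight m : K := (m ^_ a)%:R / (2 * (m - a) + 1)%:R.

Lemma weightP m : weight m * (2 * (m - a) + 1)%:R = (m ^_ a)%:R.
Proof. by rewrite /weight divfK // pnatr_eq0 addn1. Qed.

Lemma weight_eq0 m : (m < a)%N -> weight m = 0.
Proof. by move=> lt_ma; rewrite /weight ffact_small // mul0r. Qed.

Let d m : K := (2 * m + 1)%:R - (2 * a)%:R.

Let d_neq0 m : d m != 0.
Proof. by rewrite /d subr_eq0 eqr_nat; lia. Qed.

Let iter_fdiff_inv q : exists2 c : K, c != 0 &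
  forall n, iter q (@fdiff K) (fun m => (d m)^-1) n =
            c / \prod_(j < q.+1) d (n + j).
Proof.
elim: q => [|q [c c_neq0 IH]].
  by exists 1; rewrite ?oner_neq0 // => n; rewrite big_ord1 addn0 div1r.
exists (c * (- (2 * q.+1)%:R)) => [|n].
  by rewrite mulf_neq0 // oppr_eq0 pnatr_eq0.
have prodSr : \prod_(j < q.+1) d (n.+1 + j) =
    \prod_(j < q) d (n.+1 + j) * d (n + q.+1).
  by rewrite big_ord_recr addSnnS.
have prodSl r : \prod_(j < r.+1) d (n + j) = d n * \prod_(j < r) d (n.+1 + j).
  rewrite big_ord_recl addn0; congr (_ * _).
  by apply: eq_bigr => j _; rewrite /bump /= addnA addn1.
rewrite /= /fdiff !IH prodSl prodSr prodSl prodSr.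
set P := \prod_(j < q) _.
have P_neq0 : P != 0 by apply/prodf_neq0 => j _; apply: d_neq0.
have def_d : d (n + q.+1) = d n + 2 * (1 + q%:R) by rewrite /d; ring.
have dn_neq0 := d_neq0 n; have := d_neq0 (n + q.+1); rewrite def_d => dq_neq0.
by field; rewrite dq_neq0 P_neq0 dn_neq0.
Qed.

Let weightE m : weight m = (m ^_ a)%:R / d m.
Proof.
have [lt_ma|le_am] := ltnP m a; first by rewrite /weight ffact_small // !mul0r.
by rewrite /weight /d -natrB ?leq_mul2l //; last lia; congr (_ / _%:R); lia.
Qed.

Let iter_fdiff_frac b q n : (b <= q)%N ->
  iter q (@fdiff K) (fun m => (m ^_ b)%:R / d m) n =
  (\prod_(i < b) (a%:R - 2^-1 - i%:R)) *
  iter q (@fdiff K) (fun m => (d m)^-1) n.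
Proof.
elim: b q n => [|b IH] q n le_bq.
  rewrite big_ord0 mul1r; apply: eq_iter_fdiff => m.
  by rewrite ffactn0 div1r.
rewrite big_ord_recr mulrAC -(IH q n (ltnW le_bq)) mulrC.
transitivity (iter q (@fdiff K) (fun m => 2^-1 * (m ^_ b)%:R +
    (a%:R - 2^-1 - b%:R) * ((m ^_ b)%:R / d m)) n); last first.
  by rewrite iter_fdiffD !iter_fdiffZ iter_fdiff_ffact // mulr0 add0r.
apply: eq_iter_fdiff => m.
rewrite ffactnSr natrM mul_ffact_subn.
have := d_neq0 m; have -> : d m = 2 * m%:R + 1 - 2 * a%:R by rewrite /d; ring.
by move=> dm_neq0; field.
Qed.

Lemma iter_fdiff_weight_neq0 q n :
  (a <= q)%N -> iter q (@fdiff K) weight n != 0.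
Proof.
move=> le_aq; rewrite (eq_iter_fdiff q weightE) iter_fdiff_frac //.
have [c c_neq0 ->] := iter_fdiff_inv q.
rewrite !mulf_neq0 ?invr_eq0 //; apply/prodf_neq0 => i _ //.
have -> : a%:R - 2^-1 - (val i)%:R = 2^-1 * (2 * (a - i.+1) + 1)%:R :> K.
  by rewrite natrD natrM natrB // -natr1; field.
by rewrite mulf_neq0 ?invr_eq0 ?pnatr_eq0 // addn1.
Qed.

End Weights.

Section CentralForm.
Variable S : comNzRingType.
Implicit Types (g : nat -> S) (cs : seq S) (t y : S).

Definition central_form g a cs n t : S :=
  newton (fun=> 0) (fun m => g m * (t * (t ^+ 2) ^+ (m - a))) cs n.

Lemma antidiff_h0 g a cs n t : antidiff g a 0 cs n t = central_form g a cs n t.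
Proof.
apply: eq_newton => m; first by rewrite /snode !mulr0 addr0 expr0n.
congr (_ * (_ * _)); rewrite /fprod (eq_bigr (fun=> t ^+ 2)).
  by rewrite prodr_const card_ord.
by move=> j _; rewrite /snode !mulr0 addr0 expr0n subr0.
Qed.

Lemma central_form_perm g a cs cs' n t :
  perm_eq cs cs' -> central_form g a cs n t = central_form g a cs' n t.
Proof. exact: newton_perm. Qed.

Lemma central_form_nseq0 g a k cs n t :
  central_form g a (nseq k 0 ++ cs) n t = central_form g a cs (n + k) t.
Proof.
elim: k n => [|k IH] n; first by rewrite addn0.
by rewrite /central_form /= subr0 mul0r addr0 [LHS]IH addSnnS.
Qed.

Lemma central_form_square g a q n y : (forall m, (m < a)%N -> g m = 0) ->
  central_form g a (nseq q (y ^+ 2)) n y =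
  iter q (@fdiff S) g n * y ^+ (2 * (n + q - a) + 1).
Proof.
move=> g0; elim: q n => [|q IH] n.
  by rewrite /central_form /= addn0 exprD expr1 exprM [y * _]mulrC.
have := IH n; have := IH n.+1.
rewrite /central_form /= sub0r => -> ->; rewrite /fdiff addSnnS mulrBl mulNr.
congr (_ - _); have [le_a|lt_a] := leqP a (n + q).
  have -> : (2 * (n + q.+1 - a) + 1 = 2 + (2 * (n + q - a) + 1))%N by lia.
  by rewrite (exprD _ 2) mulrCA.
by rewrite iter_fdiff_eq0 ?mul0r ?mulr0 // => m le_m; rewrite g0 //; lia.
Qed.

End CentralForm.

Lemma rmorph_central_form (S S' : comNzRingType) (f : {rmorphism S -> S'})
    g a cs n t :
  f (central_form g a cs n t) = central_form (f \o g) a (map f cs) n (f t).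
Proof.
rewrite rmorph_newton; apply: eq_newton => m /=; first by rewrite rmorph0.
by rewrite !rmorphM !rmorphXn.
Qed.

Lemma poly_nonroot (K : numDomainType) (p : {poly K}) :
  p != 0 -> exists x, p.[x] != 0.
Proof.
move=> p_neq0; pose rs : seq K := [seq i%:R | i <- iota 0 (size p)].
have : ~~ all (root p) rs.
  apply/negP => roots_p; have := max_poly_roots p_neq0 roots_p.
  rewrite size_map size_iota ltnn => /(_ _)/negP; case=> //.
  by rewrite map_inj_uniq ?iota_uniq // => i j /eqP; rewrite eqr_nat => /eqP.
by case/allPn => x _ nroot; exists x.
Qed.

Section CentralDeterminant.
Variables (K : numFieldType) (a : nat).
Local Notation wt := (@weight K a).

Definition central_mx D (cs : seq K) M (u : nat -> K) : 'M[K]_D :=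
  \matrix_(i, k) central_form wt a cs (M + k) (u i).

Lemma central_form_leading q (cs : seq K) n : (a <= q)%N ->
  exists2 r : {poly K},
    central_form (polyC \o wt) a (map polyC cs ++ nseq q ('X ^+ 2)) n 'X =
      'X ^+ (2 * (n + q - a) + 1) * r &
    r.[0] = iter q (@fdiff K) wt n * \prod_(c <- cs) (- c).
Proof.
move=> le_aq; elim: cs n => [|c cs IH] n.
  exists (iter q (@fdiff K) wt n)%:P; last by rewrite hornerC big_nil mulr1.
  rewrite central_form_square => [|m lt_ma]; last by rewrite /= weight_eq0.
  rewrite mulrC; congr (_ * _).
  by elim: (q) (n) => [|p IHp] m //=; rewrite /fdiff !IHp polyCB.
have [r1 e1 r10] := IH n.+1; have [r e r0] := IH n.
exists ('X ^+ 2 * r1 - c%:P * r).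
  move: e1 e; rewrite /central_form /= => -> ->.
  have -> : (2 * (n.+1 + q - a) + 1 = 2 + (2 * (n + q - a) + 1))%N by lia.
  by rewrite (exprD _ 2); ring.
by rewrite !hornerE r0 big_cons expr0n /= mul0r; ring.
Qed.

Lemma central_mx_step D q (cs : seq K) M (u : nat -> K) : (a <= q)%N ->
  0 \notin cs -> \det (central_mx D cs (M + q).+1 u) != 0 ->
  exists2 y, y != 0 &
    \det (central_mx D.+1 (cs ++ nseq q (y ^+ 2)) M
           (fun i => if i is i'.+1 then u i' else y)) != 0.
Proof.
move=> le_aq cs_neq0 det_neq0.
have lead k := central_form_leading cs (M + k) le_aq.
have /fin_all_exists[r rP] (k : 'I_D.+1) : exists r : {poly K},
    central_form (polyC \o wt) a (map polyC cs ++ nseq q ('X ^+ 2)) (M + k) 'X =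
      'X ^+ (2 * (M + k + q - a) + 1) * r /\
    r.[0] = iter q (@fdiff K) wt (M + k) * \prod_(c <- cs) (- c).
  by have [r e r0] := lead k; exists r.
pose P : 'M[{poly K}]_D.+1 := \matrix_(i, k)
  if unlift ord0 i is Some i' then
    central_form (polyC \o wt) a (map polyC cs ++ nseq q ('X ^+ 2)) (M + k)
      (u i')%:P
  else 'X ^+ (2 * k) * r k.
have evalE y n t : horner_eval y
    (central_form (polyC \o wt) a (map polyC cs ++ nseq q ('X ^+ 2)) n t) =
    central_form wt a (cs ++ nseq q (y ^+ 2)) n t.[y].
  rewrite rmorph_central_form map_cat map_nseq -map_comp.
  have -> : map (horner_eval y \o polyC) cs = cs.
    by rewrite -[RHS]map_id; apply: eq_map => c /=; rewrite /horner_eval hornerC.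
  rewrite /= rmorphXn /= /horner_eval hornerX.
  by apply: eq_newton => m //=; rewrite /horner_eval hornerC.
have detP0 : (\det P).[0] != 0.
  have -> : (\det P).[0] = horner_eval 0 (\det P) by [].
  rewrite -det_map_mx (expand_det_row _ ord0) big_ord_recl big1 => [|k _].
    rewrite addr0 !mxE unlift_none /= muln0 expr0 mul1r.
    rewrite -[horner_eval 0 (r ord0)]/((r ord0).[0]) (rP ord0).2.
    rewrite /cofactor addn0 expr0 mul1r !mulf_neq0 ?iter_fdiff_weight_neq0 //.
      rewrite prodf_seq_neq0; apply/allP => c c_cs /=.
      by rewrite oppr_eq0; apply: contraNneq cs_neq0 => <-.
    move: det_neq0; congr (_ != 0); congr (\det _); apply/matrixP => i k.
    rewrite !mxE liftK evalE hornerC expr0n /=.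
    rewrite (central_form_perm _ _ _ _ (permEl (perm_catC _ _))).
    rewrite central_form_nseq0 /bump leq0n add1n; congr central_form; lia.
  rewrite 2!mxE unlift_none rmorphM rmorphXn /= /horner_eval hornerX.
  by rewrite /bump leq0n add1n mulnS expr0n /= !mul0r.
have [|y] := @poly_nonroot _ ('X * \det P).
  rewrite mulf_neq0 ?polyX_eq0 //.
  by apply: contraNneq detP0 => ->; rewrite horner0.
rewrite hornerM hornerX mulf_eq0 => /norP[y_neq0 detPy]; exists y => //.
pose e : 'rV[K]_D.+1 :=
  \row_i if i == ord0 then y ^+ (2 * (M + q - a) + 1) else 1.
have -> : central_mx D.+1 (cs ++ nseq q (y ^+ 2)) M
    (fun i => if i is i'.+1 then u i' else y) =
    diag_mx e *m map_mx (horner_eval y) P.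
  rewrite mul_diag_mx; apply/matrixP => i k; rewrite !mxE.
  case: unliftP => [i' ->|->] /=.
    by rewrite evalE hornerC mul1r add0n.
  have := congr1 (horner_eval y) (rP k).1; rewrite evalE hornerX => ->.
  rewrite !rmorphM !rmorphXn /= [horner_eval y 'X]hornerX mulrA -exprD.
  by congr (_ ^+ _ * _); lia.
rewrite det_mulmx det_diag det_map_mx mulf_neq0 //.
by apply/prodf_neq0 => i _; rewrite mxE; case: ifP; rewrite ?expf_neq0 ?oner_neq0.
Qed.

Definition doubled_squares D (u : nat -> K) : seq K :=
  flatten [seq nseq a (u j ^+ 2) | j <- iota 0 D].

Lemma doubled_squares_neq0 D u :
  (forall j, (j < D)%N -> u j != 0) -> 0 \notin doubled_squares D u.
Proof.
move=> u_neq0; apply/flattenP => -[c /mapP[j]].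
rewrite mem_iota add0n => /u_neq0 uj_neq0 ->.
by rewrite mem_nseq eq_sym sqrf_eq0 (negPf uj_neq0) andbF.
Qed.

Lemma central_mx_exists D M : exists2 u : nat -> K,
  forall j, (j < D)%N -> u j != 0 &
  \det (central_mx D (doubled_squares D u) M u) != 0.
Proof.
elim: D M => [|D IH] M; first by exists (fun=> 1) => //; rewrite det_mx00 oner_neq0.
have [u u_neq0 det_neq0] := IH (M + a).+1.
have [y y_neq0 det_y] := central_mx_step (leqnn a) (doubled_squares_neq0 u_neq0) det_neq0.
exists (fun i => if i is i'.+1 then u i' else y) => [[]//|].
move: det_y; congr (\det _ != 0); apply/matrixP => i k; rewrite !mxE.
apply: central_form_perm.
by rewrite perm_catC /doubled_squares /= (iotaDl 1 0) -map_comp.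
Qed.

Lemma central_mx_exists_mult D q M : (a <= q)%N -> exists u : nat -> K,
  \det (central_mx D.+1
          (nseq q (u 0 ^+ 2) ++ doubled_squares D (u \o succn)) M u) != 0.
Proof.
move=> le_aq; have [u u_neq0 det_neq0] := central_mx_exists D (M + q).+1.
have [y _ det_y] := central_mx_step le_aq (doubled_squares_neq0 u_neq0) det_neq0.
exists (fun i => if i is i'.+1 then u i' else y).
move: det_y; congr (\det _ != 0); apply/matrixP => i k; rewrite !mxE.
by apply: central_form_perm; rewrite perm_catC.
Qed.

End CentralDeterminant.

(** * Linear forms and the criterion of Saito *)

Section MPolyEvaluation.
Variable K : numFieldType.

Lemma mpoly_ring_ind n (P : {mpoly K[n]} -> Prop) :
  (forall c, P c%:MP) -> (forall i, P 'X_i) ->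
  (forall p q, P p -> P q -> P (p + q)) ->
  (forall p q, P p -> P q -> P (p * q)) ->
  forall p, P p.
Proof.
move=> PC PX PD PM; elim/mpolyind => [|c m p _ _ Pp]; first by rewrite -mpolyC0.
apply: (PD) => //; rewrite -mul_mpolyC; apply: (PM) => //.
have P1 : P 1 by rewrite -mpolyC1.
rewrite mpolyXE_id; apply: (big_ind P P1 PM) => i _.
by elim: (m i) => [|k IH]; rewrite ?expr0 // exprS; apply: PM.
Qed.

Definition ext_point n (v : 'I_n -> K) (t : K) (i : 'I_n.+1) : K :=
  if unlift ord_max i is Some j then v j else t.

Lemma meval_muni n (p : {mpoly K[n.+1]}) v t :
  p.@[ext_point v t] = (map_poly (meval v) (muni p)).[t].
Proof.
rewrite muniE mevalE raddf_sum horner_sum; apply: eq_bigr => m _.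
rewrite /= map_polyZ map_polyXn hornerZ hornerXn /= mevalZ mevalX -mulrA.
congr (_ * _); rewrite big_ord_recr /= /ext_point unlift_none; congr (_ * _).
apply: eq_bigr => i _; rewrite mnmE.
have -> : widen_ord (leqnSn n) i = lift ord_max i.
  by apply/val_inj; rewrite /= /bump leqNgt ltn_ord.
by rewrite liftK.
Qed.

Lemma muni_neq0 n (p : {mpoly K[n.+1]}) : p != 0 -> muni p != 0.
Proof.
move=> p_neq0; pose m0 := mlead p.
pose rest (m : 'X_{1..n.+1}) := [multinom m (widen_ord (leqnSn n) i) | i < n].
apply/eqP => /(congr1 (fun q : {poly _} => q`_(m0 ord_max)@_(rest m0))).
rewrite coef0 mcoeff0 muniE coef_sum raddf_sum /=.
rewrite (bigD1_seq m0) ?mlead_supp ?msupp_uniq //= big1 => [|m neq_m].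
  rewrite coefZ coefXn eqxx mulr1 mcoeffZ mcoeffX eqxx mulr1 addr0 => /eqP.
  by rewrite mleadc_eq0 (negPf p_neq0).
rewrite coefZ coefXn; have [eq_max|_] := eqVneq; last by rewrite mulr0 mcoeff0.
rewrite mulr1 mcoeffZ mcoeffX; have [eq_rest|_] := eqVneq; last by rewrite mulr0.
case/eqP: neq_m; apply/mnmP => i; case: (unliftP ord_max i) => [j ->|-> //].
have -> : lift ord_max j = widen_ord (leqnSn n) j.
  by apply/val_inj; rewrite /= /bump leqNgt ltn_ord.
by have /mnmP/(_ j) := eq_rest; rewrite !mnmE.
Qed.

Lemma mpoly_nonroot n (p : {mpoly K[n]}) :
  p != 0 -> exists v : 'I_n -> K, p.@[v] != 0.
Proof.
elim: n p => [|n IH] p p_neq0.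
  exists (fun=> 0); have def_p : p = (p@_0)%:MP.
    by apply/msize1_polyC; rewrite msizeE; apply/bigmax_leqP_seq => m _ _;
       rewrite mdegE big_ord0.
  by rewrite def_p mevalC; apply: contraNneq p_neq0; rewrite {2}def_p => ->.
have := muni_neq0 p_neq0; rewrite -lead_coef_eq0 => /IH[v v_neq0].
have [|t] := @poly_nonroot _ (map_poly (meval v) (muni p)).
  rewrite -lead_coef_eq0 lead_coef_map_eq //.
by rewrite -meval_muni; exists (ext_point v t).
Qed.

End MPolyEvaluation.

Section LinearForms.
Variables (K : numFieldType) (n : nat).
Implicit Types (b c v : 'rV[K]_n) (p q : {mpoly K[n]}).

Definition dot v b : K := \sum_i v 0 i * b 0 i.

Definition lin b : {mpoly K[n]} := \sum_i b 0 i *: 'X_i.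

Lemma dot0 v : dot v 0 = 0.
Proof. by rewrite /dot big1 // => i _; rewrite mxE mulr0. Qed.

Lemma dotD v b c : dot v (b + c) = dot v b + dot v c.
Proof. by rewrite /dot -big_split; apply: eq_bigr => i _; rewrite mxE mulrDr. Qed.

Lemma dotZ v b s : dot v (s *: b) = s * dot v b.
Proof. by rewrite /dot mulr_sumr; apply: eq_bigr => i _; rewrite mxE mulrCA. Qed.

Lemma dotN v b : dot v (- b) = - dot v b.
Proof. by rewrite -scaleN1r dotZ mulN1r. Qed.

Lemma lin_eval b (v : 'rV[K]_n) : (lin b).@[v 0] = dot v b.
Proof.
rewrite /lin raddf_sum; apply: eq_bigr => i _ /=.
by rewrite mevalZ mevalXU mulrC.
Qed.

Lemma lin_homog b : lin b \is 1.-homog.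
Proof. by apply: rpred_sum => i _; rewrite rpredZ // dhomogX /= mdeg1. Qed.

Lemma lin_coef p : p \is 1.-homog -> p = lin (\row_i p@_U_(i)).
Proof.
move=> p_homog; apply/mpolyP => m; rewrite /lin raddf_sum /=.
under eq_bigr => i _ do rewrite mxE mcoeffZ mcoeffX.
have [/mdeg1P[i /eqP->]|m_neq1] := boolP (mdeg m == 1%N).
  rewrite (bigD1 i) //= eqxx mulr1 big1 ?addr0 // => j neq_ji.
  by rewrite eq_mnm1 (negPf neq_ji) mulr0.
rewrite (dhomog_nemf_coeff p_homog) // big1 // => i _.
by case: eqP => [def_m|_]; [rewrite -def_m mdeg1 in m_neq1 | rewrite mulr0].
Qed.

Lemma lin_neq0 b : b != 0 -> lin b != 0.
Proof.
move=> b_neq0; apply: contraNneq b_neq0 => lin0; apply/eqP/rowP => i.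
have := congr1 (mcoeff U_(i)) lin0; rewrite mcoeff0 /lin raddf_sum mxE => <- /=.
rewrite (bigD1 i) //= mcoeffZ mcoeffX eqxx mulr1 big1 ?addr0 // => j neq_ji.
by rewrite mcoeffZ mcoeffX eq_mnm1 (negPf neq_ji) mulr0.
Qed.

(* Substituting for 'X_k the linear form that agrees with it on the kernel
   of [lin b] projects onto a polynomial ring, with kernel (lin b). *)
Let red b k : n.-tuple {mpoly K[n]} :=
  [tuple 'X_i - (if i == k then (b 0 k)^-1 else 0) *: lin b | i < n].

Lemma red_dvd b k p : exists q, p = p \mPo red b k + lin b * q.
Proof.
elim/mpoly_ring_ind: p => [c|i|p p' [q e] [q' e']|p p' [q e] [q' e']].
- by exists 0; rewrite mulr0 addr0 comp_mpolyC.
- exists (if i == k then (b 0 k)^-1 else 0)%:MP.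
  rewrite comp_mpolyXU -tnth_nth tnth_mktuple mulrC mul_mpolyC.
  by rewrite subrK.
- by exists (q + q'); rewrite {1}e {1}e' rmorphD /=; ring.
exists ((p \mPo red b k) * q' + q * (p' \mPo red b k) + lin b * q * q').
by rewrite {1}e {1}e' rmorphM /=; ring.
Qed.

Lemma red_eval b k p v : b 0 k != 0 ->
  exists2 v', dot v' b = 0 &
    (dot v b = 0 -> v' = v) /\ (p \mPo red b k).@[v 0] = p.@[v' 0].
Proof.
move=> bk_neq0; exists (v - (dot v b / b 0 k) *: delta_mx 0 k).
  rewrite /dot (eq_bigr (fun i => v 0 i * b 0 i -
      (dot v b / b 0 k) * ((i == k)%:R * b 0 i))) => [|i _]; last first.
    by rewrite !mxE eqxx mulrBl mulrA.
  rewrite sumrB -mulr_sumr [X in _ - _ * X](bigD1 k) //= eqxx mul1r.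
  rewrite [X in _ * (_ + X)]big1 => [|i /negPf->]; last by rewrite mul0r.
  by rewrite addr0 divfK // subrr.
split=> [->|]; first by rewrite mul0r scale0r subr0.
rewrite comp_mpoly_meval; apply: meval_eq => i.
rewrite tnth_mktuple mevalB mevalXU mevalZ lin_eval !mxE eqxx /=.
by case: eqP => _; rewrite ?(mulr1, mulr0, mul0r) // mulrC.
Qed.

Lemma row_neq0P b : b != 0 -> exists k, b 0 k != 0.
Proof. by move=> /rV0Pn. Qed.

Lemma lin_dvd b p : b != 0 ->
  (forall v, dot v b = 0 -> p.@[v 0] = 0) -> exists q, p = lin b * q.
Proof.
move=> /row_neq0P[k bk_neq0] p0; have [q e] := red_dvd b k p; exists q.
rewrite {1}e; suff -> : p \mPo red b k = 0 by rewrite add0r.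
apply/eqP/negPn/negP => /mpoly_nonroot[v].
have [v' v'b [_]] := red_eval p (\row_i v i) bk_neq0.
rewrite (@meval_eq _ _ _ v) => [->|i]; last by rewrite mxE.
by rewrite p0 ?eqxx.
Qed.

Lemma lin_dvd_mul b c q r v : b != 0 -> dot v b = 0 -> dot v c != 0 ->
  lin c * q = lin b * r -> exists q', q = lin b * q'.
Proof.
move=> b_neq0 vb vc eq_qr; apply: lin_dvd => // w wb.
have [k bk_neq0] := row_neq0P b_neq0.
have red_lin0 : lin b \mPo red b k = 0.
  apply/eqP/negPn/negP => /mpoly_nonroot[u].
  have [u' u'b [_]] := red_eval (lin b) (\row_i u i) bk_neq0.
  rewrite (@meval_eq _ _ _ u) => [->|i]; last by rewrite mxE.
  by rewrite lin_eval u'b eqxx.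
have := congr1 (comp_mpoly (red b k)) eq_qr; rewrite !rmorphM /= red_lin0 mul0r.
move/eqP; rewrite mulf_eq0 => /orP[] /eqP red0.
  have [v' _ [/(_ vb) -> ]] := red_eval (lin c) v bk_neq0.
  by rewrite red0 meval0 lin_eval => vc0; rewrite -vc0 eqxx in vc.
by have [w' _ [/(_ wb) -> <-]] := red_eval q w bk_neq0; rewrite red0 meval0.
Qed.

Definition nonproportional b c :=
  exists v : 'rV[K]_n, dot v b = 0 /\ dot v c != 0.

Lemma lin_prod_dvd (L : seq 'rV[K]_n) p :
  uniq L -> (forall b, b \in L -> b != 0) ->
  {in L &, forall b c, b != c -> nonproportional b c} ->
  (forall b, b \in L -> exists q, p = lin b * q) ->
  exists q, p = (\prod_(b <- L) lin b) * q.
Proof.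
elim: L p => [|c L IH] p /=; first by exists p; rewrite big_nil mul1r.
case/andP=> c_notin uniqL L_neq0 np dvd_p.
have [q def_p] := dvd_p c (mem_head _ _).
have [|||r def_q] := IH q uniqL.
- by move=> b bL; apply: L_neq0; rewrite inE bL orbT.
- by move=> b b' bL b'L; apply: np; rewrite inE ?bL ?b'L orbT.
- move=> b bL; have bcL : b \in c :: L by rewrite inE bL orbT.
  have [r def_r] := dvd_p b bcL.
  have neq_bc : b != c by apply: contraNneq c_notin => <-.
  have [v [vb vc]] := np b c bcL (mem_head _ _) neq_bc.
  by apply: (lin_dvd_mul (L_neq0 b bcL) vb vc (r := r)); rewrite -def_p.
by exists r; rewrite big_cons def_p def_q mulrA.
Qed.

End LinearForms.

Section Derivations.
Variables (R : realType) (n : nat).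
Implicit Types (theta : {mpoly R[n]} -> {mpoly R[n]}) (p : {mpoly R[n]}).

Lemma mderivXU i j : ('X_i : {mpoly R[n]})^`M(j) = (i == j)%:R.
Proof.
rewrite mderivX mnm1E; have [->|_] := eqVneq; last by rewrite scale0r.
by rewrite scale1r -mpolyX0; congr 'X_[_]; apply/mnmP => k; rewrite mnmBE subnn mnm0E.
Qed.

Lemma derivation_sum theta (I : Type) (s : seq I) (F : I -> {mpoly R[n]}) c :
  is_derivation theta ->
  theta (\sum_(i <- s) c i *: F i) = \sum_(i <- s) c i *: theta (F i).
Proof.
case=> theta_lin _; have theta0 : theta 0 = 0.
  by have := theta_lin (-1) 0 0; rewrite !scaleN1r !addNr.
by elim: s => [|i s IH]; rewrite ?big_nil // !big_cons theta_lin IH.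
Qed.

Lemma derivationE theta p :
  is_derivation theta -> theta p = \sum_j theta 'X_j * p^`M(j).
Proof.
move=> [theta_lin thetaM]; have thetaD q r : theta (q + r) = theta q + theta r.
  by have := theta_lin 1 q r; rewrite !scale1r.
have theta1 : theta 1 = 0.
  have := thetaM 1 1; rewrite !mul1r mulr1 => /eqP.
  by rewrite -subr_eq0 opprD addrA subrr add0r oppr_eq0 => /eqP.
have theta0 : theta 0 = 0.
  by have := theta_lin (-1) 0 0; rewrite !scaleN1r !addNr.
elim/mpoly_ring_ind: p => [c|i|p q IHp IHq|p q IHp IHq].
- rewrite big1 => [|j _]; last by rewrite mderivC mulr0.
  by have := theta_lin c 1 0; rewrite theta0 theta1 !addr0 scaler0 -mul_mpolyC mulr1.
- rewrite (bigD1 i) //= big1 => [|j neq_ji].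
    by rewrite mderivXU eqxx mulr1 addr0.
  by rewrite mderivXU eq_sym (negPf neq_ji) mulr0.
- rewrite thetaD IHp IHq -big_split; apply: eq_bigr => j _.
  by rewrite mderivD mulrDr.
rewrite thetaM IHp IHq mulr_suml mulr_sumr -big_split; apply: eq_bigr => j _.
by rewrite mderivM /=; ring.
Qed.

Definition vfield (psi : 'I_n -> {mpoly R[n]}) p : {mpoly R[n]} :=
  \sum_j psi j * p^`M(j).

Lemma vfield_derivation psi : is_derivation (vfield psi).
Proof.
split=> [c p q|p q].
  rewrite /vfield scaler_sumr -big_split; apply: eq_bigr => j _.
  by rewrite linearP mulrDr scalerAr.
rewrite /vfield mulr_suml mulr_sumr -big_split; apply: eq_bigr => j _.
by rewrite mderivM /=; ring.
Qed.

Lemma vfieldX psi i : vfield psi 'X_i = psi i.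
Proof.
rewrite /vfield (bigD1 i) //= big1 => [|j neq_ji].
  by rewrite mderivXU eqxx mulr1 addr0.
by rewrite mderivX mnm1E eq_sym (negPf neq_ji) scale0r mulr0.
Qed.

End Derivations.

Section SaitoCriterion.
Variable R : realType.

Lemma linear_hyperplaneE n (b v : 'rV[R]_n) :
  (v \in linear_hyperplane b) = (dot v b == 0).
Proof.
rewrite memv_ker lfunE /= -[_ == _]/(v *m b^T == 0).
have dotE : (v *m b^T) 0 0 = dot v b by rewrite mxE; apply: eq_bigr => k _; rewrite mxE.
apply/eqP/eqP => [vb0|]; first by rewrite -dotE vb0 mxE.
by rewrite -dotE => vb0; apply/matrixP => i j; rewrite !ord1 vb0 mxE.
Qed.

Lemma linear_hyperplane_form n (b : 'rV[R]_n) :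
  defining_form (linear_hyperplane b) (lin b).
Proof. by split=> [|v]; rewrite ?lin_homog // linear_hyperplaneE lin_eval. Qed.

Definition tangent_row n (u : 'I_n -> {mpoly R[n]}) (b : 'rV[R]_n) :=
  exists q, \sum_j b 0 j *: u j = lin b * q.

Lemma lin_dvd_det n (N : 'M[{mpoly R[n]}]_n) b : b != 0 ->
  (forall k, tangent_row (N k) b) -> exists q, \det N = lin b * q.
Proof.
move=> /row_neq0P[j bj_neq0] /fin_all_exists[q qP].
pose B : 'cV[{mpoly R[n]}]_n := \col_i (b 0 i)%:MP_[n].
have NB : N *m B = lin b *: \col_k q k.
  apply/colP => k; rewrite !mxE -qP; apply: eq_bigr => i _.
  by rewrite mxE mulrC mul_mpolyC.
exists ((b 0 j)^-1 *: (\adj N *m \col_k q k) j 0).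
have := congr1 (fun A : 'cV_n => A j 0) (mulmxA (\adj N) N B).
rewrite mul_adj_mx NB -scalemxAr mul_scalar_mx [in LHS]mxE [in RHS]mxE => eq_det.
by rewrite -scalerAr eq_det [B j 0]mxE mulrC mul_mpolyC scalerA mulVf ?scale1r.
Qed.

Lemma dhomog_bigprod n d (p : 'I_d -> {mpoly R[n]}) (e : 'I_d -> nat) :
  (forall i, p i \is (e i).-homog) ->
  \prod_(i < d) p i \is (\sum_(i < d) e i)%N.-homog.
Proof.
move=> p_homog; apply: (big_ind2 (fun q k => q \is k.-homog)) => [|q k q' k'|i _].
- exact: dhomog1.
- exact: dhomogM.
- exact: p_homog.
Qed.

Lemma det_homog n d (N : 'M[{mpoly R[n]}]_d) (e : 'I_d -> nat) :
  (forall i j, N i j \is (e i).-homog) -> \det N \is (\sum_(i < d) e i)%N.-homog.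
Proof.
move=> N_homog; apply: rpred_sum => s _; rewrite rpredMsign.
exact: dhomog_bigprod.
Qed.

Lemma lin_prod_homog n (L : seq 'rV[R]_n) :
  \prod_(b <- L) lin b \is (size L).-homog.
Proof.
elim: L => [|b L IH]; first by rewrite big_nil dhomog1.
by rewrite big_cons; apply: dhomogM (lin_homog b) IH.
Qed.

Lemma homog_quotient n k (p q : {mpoly R[n]}) :
  p != 0 -> p \is k.-homog -> p * q \is k.-homog -> q = (q@_0)%:MP.
Proof.
move=> p_neq0 p_homog pq_homog; apply: msize1_polyC.
have [->|q_neq0] := eqVneq q 0; first by rewrite msize0.
have size_homog (r : {mpoly R[n]}) : r != 0 -> r \is k.-homog -> msize r = k.+1.
  move=> r_neq0 /dhomogP r_homog; rewrite -mlead_deg //; congr _.+1.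
  exact: r_homog (mlead_supp r_neq0).
have := msizeM p_neq0 q_neq0.
rewrite (size_homog _ p_neq0 p_homog).
rewrite (size_homog _ (mulf_neq0 p_neq0 q_neq0) pq_homog) addSn /= => eq_k.
by rewrite -(leq_add2l k) addn1 eq_k.
Qed.

Theorem saito_criterion d (A : arrangement R d) (e : seq nat)
    (P : 'M[{mpoly R[d]}]_d) (L : seq 'rV[R]_d) :
  size e = d ->
  (forall k j, P k j \is (nth 0%N e k).-homog) ->
  (forall k H (v : 'rV_d), H \in A -> v \in H -> \row_j (P k j).@[v 0] \in H) ->
  (forall b, b \in L -> b != 0 /\ linear_hyperplane b \in A) ->
  uniq L -> {in L &, forall b c, b != c -> nonproportional b c} ->
  size L = sumn e -> \det P != 0 ->
  free_with_exponents A e.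
Proof.
move=> size_e; subst d => P_homog P_tangent L_A uniqL L_np size_L detP_neq0.
have L_neq0 b : b \in L -> b != 0 by move=> /L_A[].
have dvd_det (N : 'M[{mpoly R[size e]}]_(size e)) :
    (forall b k, b \in L -> tangent_row (N k) b) ->
    exists q, \det N = (\prod_(b <- L) lin b) * q.
  move=> N_tan; apply: lin_prod_dvd => // b bL.
  by apply: lin_dvd_det => [|k]; [apply: L_neq0 | apply: N_tan].
have P_log k : log_derivation A (vfield (P k)).
  split=> [|H alpha HA [alpha_homog alphaP]]; first exact: vfield_derivation.
  rewrite (lin_coef alpha_homog) in alphaP *; set b := \row_i _ in alphaP *.
  have [->|b_neq0] := eqVneq b 0.
    exists 0; rewrite mulr0 /lin derivation_sum; last exact: vfield_derivation.
    by rewrite big1 // => i _; rewrite mxE scale0r.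
  apply: lin_dvd => // v; rewrite -lin_eval => /eqP; rewrite -alphaP => vH.
  have := P_tangent k H v HA vH; rewrite alphaP lin_eval => /eqP <-.
  rewrite /lin derivation_sum; last exact: vfield_derivation.
  rewrite raddf_sum; apply: eq_bigr => j _ /=.
  by rewrite vfieldX mevalZ mxE mulrC.
have log_tangent theta b : log_derivation A theta -> b \in L ->
    tangent_row (fun j => theta 'X_j) b.
  move=> [theta_der theta_log] bL; have [_ HA] := L_A b bL.
  have [q def_q] := theta_log _ _ HA (linear_hyperplane_form b).
  by exists q; rewrite -def_q /lin derivation_sum.
have P_row b k : b \in L -> tangent_row (P k) b.
  move=> bL; have [q def_q] := log_tangent _ b (P_log k) bL; exists q.
  by rewrite -def_q; apply: eq_bigr => j _; rewrite vfieldX.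
pose Q := \prod_(b <- L) lin b.
have Q_neq0 : Q != 0.
  by rewrite prodf_seq_neq0; apply/allP => b bL; rewrite lin_neq0 ?L_neq0.
have [q0 def_det] := dvd_det P (fun b k => @P_row b k).
have sum_e : (\sum_(k < size e) nth 0 e k = size L)%N.
  by rewrite size_L sumnE (big_nth 0%N) big_mkord.
have [c c_neq0 det_c] : exists2 c, c != 0 & \det P = c *: Q.
  have def_q0 : q0 = (q0@_0)%:MP.
    apply: (homog_quotient Q_neq0 (lin_prod_homog L)).
    by rewrite -def_det -sum_e; apply: det_homog.
  exists q0@_0; last by rewrite def_det {1}def_q0 mulrC mul_mpolyC.
  by apply: contraNneq detP_neq0 => q00; rewrite def_det def_q0 q00 mulr0.
exists (fun k => vfield (P k)); split=> // [k i|eta eta_log].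
  by rewrite vfieldX.
pose y : 'rV_(size e) := \row_j eta 'X_j.
have /fin_all_exists[q qP] (k : 'I_(size e)) :
    exists q, (y *m \adj P) 0 k = Q * q.
  pose N : 'M_(size e) := \matrix_(i, j) if i == k then y 0 j else P i j.
  have [b i bL|q def_q] := dvd_det N.
    rewrite /tangent_row; have [->|neq_ik] := eqVneq i k.
      have [q def_q] := log_tangent _ _ eta_log bL; exists q.
      by rewrite -def_q; apply: eq_bigr => j _; rewrite !mxE eqxx.
    have [q def_q] := P_row b i bL; exists q.
    by rewrite -def_q; apply: eq_bigr => j _; rewrite !mxE (negPf neq_ik).
  exists q; rewrite -def_q (expand_det_row N k) mxE; apply: eq_bigr => j _.
  rewrite !mxE eqxx; congr (_ * _); rewrite /cofactor; congr (_ * \det _).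
  by apply/matrixP => i1 j1; rewrite !mxE eq_sym (negPf (neq_lift _ _)).
have cancel_det (u w : 'rV[{mpoly R[size e]}]_(size e)) :
    \det P *: u = \det P *: w -> u = w.
  move=> /rowP eq_uw; apply/rowP => j; have := eq_uw j.
  by rewrite !mxE => /(mulfI detP_neq0).
have eta_row : y = \row_k (c^-1 *: q k) *m P.
  apply: cancel_det; rewrite -mul_mx_scalar -mul_adj_mx mulmxA.
  rewrite scalemxAl; congr (_ *m _); apply/rowP => k.
  rewrite qP !mxE det_c -scalerAl -scalerAr scalerA.
  by rewrite mulfV ?scale1r.
exists [ffun k => c^-1 *: q k]; split=> [p|c' c'P].
  rewrite (derivationE p eta_log.1).
  transitivity (\sum_j (\sum_k (c^-1 *: q k) * P k j) * p^`M(j)).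
    apply: eq_bigr => j _; congr (_ * _).
    have := congr1 (fun A : 'rV_(size e) => A 0 j) eta_row; rewrite !mxE => ->.
    by apply: eq_bigr => k _; rewrite mxE.
  under eq_bigr => j _ do rewrite mulr_suml.
  rewrite exchange_big; apply: eq_bigr => k _; rewrite ffunE mulr_sumr.
  by apply: eq_bigr => j _; rewrite mulrA.
have eta_row' : y = \row_k c' k *m P.
  apply/rowP => j; rewrite !mxE c'P; apply: eq_bigr => k _.
  by rewrite vfieldX mxE.
apply/ffunP => k; rewrite ffunE.
have := congr1 (mulmx^~ (\adj P)) (etrans (esym eta_row) eta_row').
rewrite /= -!mulmxA mul_mx_adj !mul_mx_scalar => /cancel_det.
by move/rowP/(_ k); rewrite !mxE.
Qed.

End SaitoCriterion.

(** * The logarithmic fields of the cone *)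

Section ConeFields.
Variables (R : realType) (l m a : nat).
Local Notation wt := (@weight R a).

Definition cone_forms (A : affine_arrangement R l) : seq 'rV[R]_(l + 1) :=
  row_mx 0 1%:M :: [seq row_mx h.1 (- h.2)%:M | h <- A].

Lemma coneE A : cone A = [seq linear_hyperplane b | b <- cone_forms A].
Proof. by rewrite /cone /= -map_comp. Qed.

Lemma dot_row_mx (v : 'rV[R]_(l + 1)) c s :
  dot v (row_mx c s%:M) = dot (lsubmx v) c + v 0 (rshift l ord0) * s.
Proof.
rewrite /dot big_split_ord big_ord1 /= row_mxEr mxE eqxx mulr1n; congr (_ + _).
by apply: eq_bigr => i _; rewrite row_mxEl mxE.
Qed.

Lemma dot_x_ n (v : 'rV[R]_n) i : dot v (x_ R i) = v 0 i.
Proof.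
rewrite /dot (bigD1 i) //= mxE !eqxx mulr1 big1 ?addr0 // => j neq_ji.
by rewrite mxE (negPf neq_ji) andbF mulr0.
Qed.

Lemma int_rangeP k (s : R) :
  s \in int_range R k -> exists2 s0, (s0 <= k)%N & s = s0%:R \/ s = - s0%:R.
Proof.
case/mapP=> j; rewrite mem_iota => lt_j ->; have [le_kj|lt_jk] := leqP k j.
  by exists (j - k)%N; [lia | left; rewrite natrB].
by exists (k - j)%N; [lia | right; rewrite natrB ?opprB // ltnW].
Qed.

Section FieldValues.
Variables (h : R) (x : 'I_l -> R) (k : nat).
Local Notation V := (field_value wt a h k x).

Lemma field_value_pair i j s w w' :
  i != j -> s \in int_range R a ->
  w = x i \/ w = - x i -> w' = x j \/ w' = - x j ->
  w' = w + s * (2 * h) -> V w' = V w.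
Proof.
have sym i0 y : y = x i0 \/ y = - x i0 ->
    perm_eq (shifted_squares a h (x i0)) (shifted_squares a h y).
  by case=> -> //; rewrite perm_sym shifted_squaresN.
move=> neq_ij /int_rangeP[s0 le_s0 [] ->] /sym w_i /sym w'_j def_w'.
  by apply: (field_value_shift2 (@weightP R a) k neq_ij le_s0) => //; rewrite def_w'; ring.
apply/esym; rewrite eq_sym in neq_ij.
by apply: (field_value_shift2 (@weightP R a) k neq_ij le_s0) => //; rewrite def_w'; ring.
Qed.

Lemma field_value_double i s : (m <= k)%N ->
  s \in int_range R m -> x i = s * h -> V (x i) = 0.
Proof.
move=> le_mk /int_rangeP[s0 le_s0 [] ->] def_xi.
  rewrite def_xi; apply: (field_value_reflect (@weightP R a) (i := i)).
    exact: leq_trans le_mk.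
  by rewrite def_xi.
rewrite def_xi mulNr field_value_odd.
rewrite (field_value_reflect (@weightP R a) (i := i)) ?oppr0 //.
  exact: leq_trans le_mk.
by rewrite def_xi mulNr shifted_squaresN.
Qed.

End FieldValues.

(* With z = 2 h: the Euler field, followed by the fields sum_i F_k(x_i) d/dx_i. *)
Definition cone_field (k : nat) (i : 'I_(l + 1)) : {mpoly R[l + 1]} :=
  if k is k'.+1 then
    if split i is inl j then
      field_value (@mpolyC _ _ \o wt) a (2^-1 *: 'X_(rshift l ord0)) (m + k')
        (fun j => 'X_(lshift 1 j)) 'X_i
    else 0
  else 'X_i.

Lemma rmorph_field_value (S S' : comNzRingType) (f : {rmorphism S -> S'})
    g h k (x : 'I_l -> S) t :
  f (field_value g a h k x t) = field_value (f \o g) a (f h) k (f \o x) (f t).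
Proof.
rewrite rmorph_antidiff /field_value; congr antidiff.
rewrite /squares map_cat map_flatten -!map_comp; congr (_ ++ flatten _).
  by apply: eq_map => r /=; rewrite rmorphXn rmorphM rmorphB !rmorph_nat.
apply: eq_map => j /=; rewrite /shifted_squares rmorph_snodes.
by rewrite rmorphD rmorphM rmorphB rmorph1 rmorph_nat.
Qed.

Lemma eq_field_value (S : comNzRingType) g g' (h : S) k (x x' : 'I_l -> S) t :
  g =1 g' -> x =1 x' -> field_value g a h k x t = field_value g' a h k x' t.
Proof.
move=> eq_g eq_x; rewrite /field_value /antidiff /squares.
rewrite (eq_map (fun j => congr1 (shifted_squares a h) (eq_x j))).
by apply: eq_newton => // n; rewrite eq_g.
Qed.

Lemma cone_field_eval k (v : 'rV[R]_(l + 1)) :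
  \row_i (cone_field k.+1 i).@[v 0] =
  row_mx (\row_j field_value wt a (2^-1 * v 0 (rshift l ord0)) (m + k)
             (fun j => v 0 (lshift 1 j)) (v 0 (lshift 1 j))) 0.
Proof.
apply/rowP => i; rewrite !mxE /=; case: splitP => j def_i; last by rewrite meval0 mxE.
rewrite rmorph_field_value /= mevalZ !mevalXU mxE.
have -> : i = lshift 1 j by apply/val_inj.
by apply: eq_field_value => [n|j'] /=; rewrite ?mevalC ?mevalXU.
Qed.

Lemma cone_field_tangent k (b v : 'rV[R]_(l + 1)) :
  b \in cone_forms (C0 R l m a) -> dot v b = 0 ->
  dot (\row_i (cone_field k i).@[v 0]) b = 0.
Proof.
case: k => [|k] b_form.
  by move=> <-; congr dot; apply/rowP => i; rewrite mxE mevalXU.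
rewrite cone_field_eval; case/predU1P: b_form => [-> _|/mapP[[c s] cs_C0 ->]].
  by rewrite dot_row_mx row_mxKl row_mxEr mxE mul0r addr0 dot0.
rewrite !dot_row_mx row_mxKl row_mxEr mxE mul0r addr0 => /eqP.
set z := v 0 (rshift l ord0); pose h := 2^-1 * z.
rewrite mulrN subr_eq0 => /eqP vcs.
have def_z : z = 2 * h by rewrite /h mulrA mulfV ?mul1r // pnatr_eq0.
have le_mk : (m <= m + k)%N by rewrite leq_addr.
move: cs_C0 vcs; rewrite !mem_cat => /or3P[] /allpairsP[[p s'] /= [p_in s_in [-> ->]]].
- move: p_in; rewrite mem_filter => /andP[lt_p _].
  have neq_p : p.1 != p.2 by rewrite -val_eqE ltn_eqF.
  rewrite !dotD !dot_x_ !mxE => def_s; apply/eqP; rewrite addr_eq0 -field_value_odd.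
  apply/eqP; rewrite eq_sym in neq_p.
  apply: (field_value_pair _ neq_p s_in); [by right|by left|].
  by rewrite -def_z mulrC -def_s; ring.
- move: p_in; rewrite mem_filter => /andP[lt_p _].
  have neq_p : p.1 != p.2 by rewrite -val_eqE ltn_eqF.
  rewrite !dotD !dotN !dot_x_ !mxE => def_s; apply/eqP; rewrite subr_eq0.
  apply/eqP; rewrite eq_sym in neq_p.
  apply: (field_value_pair _ neq_p s_in); [by left|by left|].
  by rewrite -def_z mulrC -def_s; ring.
rewrite !dotZ !dot_x_ !mxE => def_s.
rewrite (field_value_double le_mk s_in) ?mulr0 //.
by apply: (@mulfI _ 2); rewrite ?pnatr_eq0 // def_s mulrCA -def_z mulrC.
Qed.

Lemma newton_homog n (A base : nat -> {mpoly R[n]}) cs k :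
  (forall j, A j \is 2.-homog) ->
  (forall j, base j \is (2 * (j - a) + 1).-homog) ->
  (forall j, (j < a)%N -> base j = 0) ->
  (forall c, c \in cs -> c \is 2.-homog) ->
  newton A base cs k \is (2 * (size cs + k - a) + 1).-homog /\
  ((size cs + k < a)%N -> newton A base cs k = 0).
Proof.
move=> A_homog base_homog base0; elim: cs k => [|c cs IH] k cs_homog /=.
  by split=> [|/base0]; rewrite ?base_homog.
have cs_homog' c' : c' \in cs -> c' \is 2.-homog.
  by move=> c'_cs; rewrite cs_homog // inE c'_cs orbT.
have [IH1 IH1'] := IH k.+1 cs_homog'; have [IH2 IH2'] := IH k cs_homog'.
have deg_eq N : (a <= N + k -> 2 * (N + k.+1 - a) + 1 = 2 + (2 * (N + k - a) + 1))%N.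
  by lia.
rewrite addSnnS; split=> [|lt_a]; last first.
  by rewrite IH1' // IH2' ?mulr0 ?addr0 // (leq_trans _ lt_a) // addnS.
rewrite rpredD //; have [lt_a|le_a] := ltnP (size cs + k) a.
  by rewrite IH2' // mulr0 rpred0.
rewrite (deg_eq _ le_a).
by apply: dhomogM IH2; rewrite rpredB ?A_homog // cs_homog ?mem_head.
Qed.

Lemma size_squares (S : comNzRingType) (h : S) k (x : 'I_l -> S) :
  size (squares a h k x) = (k + l * a)%N.
Proof.
rewrite size_cat size_map size_iota size_flatten /shape -map_comp.
rewrite (eq_map (g := fun=> a)) => [|j]; last by rewrite /= /snodes size_map size_iota.
by rewrite sumnE big_map big_enum sum_nat_const card_ord.
Qed.

Lemma cone_field_homog k i : (0 < l)%N ->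
  cone_field k i \is (if k is k'.+1 then 2 * (a * l.-1 + m + k') + 1 else 1)%N.-homog.
Proof.
move=> l_gt0; case: k => [|k] /=; first by rewrite dhomogX /= mdeg1.
case: splitP => [j _|]; last by rewrite rpred0.
set h := 2^-1 *: _.
have h_homog : h \is 1.-homog by rewrite rpredZ // dhomogX /= mdeg1.
have X_homog i' : ('X_i' : {mpoly R[l + 1]}) \is 1.-homog by rewrite dhomogX /= mdeg1.
have nat_homog r (p : {mpoly R[l + 1]}) e : p \is e.-homog -> r%:R * p \is e.-homog.
  by move=> p_homog; rewrite mulr_natl rpredMn.
have natB_homog r r' (p : {mpoly R[l + 1]}) e : p \is e.-homog ->
    (r%:R - r'%:R) * p \is e.-homog.
  by move=> p_homog; rewrite mulrBl rpredB ?nat_homog.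
have sq_homog (p : {mpoly R[l + 1]}) : p \is 1.-homog -> p ^+ 2 \is 2.-homog.
  exact: dhomogMn.
have snode_homog s j' : s \is 1.-homog -> snode s h j' \is 2.-homog.
  by move=> s_homog; apply: sq_homog; rewrite rpredD // nat_homog.
have fprod_homog s r t : s \is 1.-homog -> t \is 1.-homog ->
    fprod s h r t \is (2 * r).-homog.
  move=> s_homog t_homog; rewrite /fprod.
  have -> : (2 * r = \sum_(j < r) 2)%N by rewrite sum_nat_const card_ord mulnC.
  by apply: dhomog_bigprod => j'; rewrite rpredB //; [apply: sq_homog|apply: snode_homog].
have [] := @newton_homog _ (snode ((1 - a%:R) * h) h)
  (fun r => wt r *: ('X_i * fprod (2 * h) h (r - a) 'X_i))
  (squares a h (m + k) (fun j => 'X_(lshift 1 j))) 0.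
- by move=> j'; rewrite snode_homog // (natB_homog 1%N).
- move=> r; rewrite rpredZ // (addnC (2 * (r - a))%N); apply: dhomogM => //.
  by apply: fprod_homog => //; apply: nat_homog.
- by move=> r lt_ra; rewrite weight_eq0 // scale0r.
- move=> c; rewrite mem_cat => /orP[/mapP[r _ ->]|/flattenP[ss /mapP[j' _ ->]]].
    by rewrite sq_homog // natB_homog.
  by case/mapP=> r _ ->; rewrite snode_homog // rpredD // (natB_homog 1%N).
rewrite size_squares addn0 => V_homog _.
have -> : (2 * (a * l.-1 + m + k) + 1 = 2 * (m + k + l * a - a) + 1)%N.
  by case: (l) l_gt0 => // l'; lia.
move: V_homog; congr (_ \is _); apply: eq_newton => // r /=.
by rewrite mul_mpolyC.
Qed.

End ConeFields.

(** * The flag and its restrictions *)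

Section C0Membership.
Variables (R : realType) (l m a : nat).

Lemma lsubmx_x (w : 'rV[R]_(l.+1 + 1)) i : lsubmx w 0 i = w 0 (lshift 1 i).
Proof. by rewrite mxE. Qed.

Lemma mem_int_range k r : (r <= 2 * k)%N -> r%:R - k%:R \in int_range R k.
Proof. by move=> le_rk; apply/mapP; exists r; rewrite // mem_iota; lia. Qed.

Lemma C0_sub r1 r2 s : (r1 < r2 <= l)%N -> s \in int_range R a ->
  (x_ R (inord r1 : 'I_l.+1) - x_ R (inord r2), s) \in C0 R l.+1 m a.
Proof.
move=> lt_r s_in; rewrite !mem_cat; apply/or3P/Or32/allpairsP.
exists (((inord r1, inord r2) : 'I_l.+1 * 'I_l.+1), s); split=> //.
by rewrite mem_filter mem_enum andbT /= !inordK; lia.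
Qed.

Lemma C0_add r1 r2 s : (r1 < r2 <= l)%N -> s \in int_range R a ->
  (x_ R (inord r1 : 'I_l.+1) + x_ R (inord r2), s) \in C0 R l.+1 m a.
Proof.
move=> lt_r s_in; rewrite !mem_cat; apply/or3P/Or31/allpairsP.
exists (((inord r1, inord r2) : 'I_l.+1 * 'I_l.+1), s); split=> //.
by rewrite mem_filter mem_enum andbT /= !inordK; lia.
Qed.

Lemma C0_double r s : s \in int_range R m ->
  (2 *: x_ R (inord r : 'I_l.+1), s) \in C0 R l.+1 m a.
Proof.
move=> s_in; rewrite !mem_cat; apply/or3P/Or33/allpairsP.
by exists ((inord r : 'I_l.+1), s); split=> //; rewrite mem_enum.
Qed.

End C0Membership.

Section FlagStep.
Variables (R : realType) (l m a D : nat).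
Hypothesis le_Dl : (D <= l.+1)%N.
Let q := (l - D.-1)%N.
Local Notation n := (l.+1 + 1)%N.
Implicit Types (u : 'rV[R]_(D + 1)) (w : 'rV[R]_n).
Local Notation pos r := (lshift 1 (inord r%N : 'I_l.+1)).

(* The coordinates (u_0, ..., u_{D-1}, z) of the flat
   x_0 = u_0 - q a z, ..., x_{q-1} = u_0 - a z, x_q = u_0, ..., x_l = u_{D-1};
   for D = 0 there is no u_0 and it is read as 0. *)
Definition flag_mx : 'M[R]_(D + 1, n) :=
  block_mx (\matrix_(j, i) (i - q == j)%N%:R) 0
           (\row_i - ((q - i) * a)%N%:R) 1%:M.

Definition flag_col (j : 'I_(D + 1)) : 'I_n :=
  if split j is inl j' then pos (q + j') else rshift l.+1 ord0.

Definition flag_map : 'Hom('rV[R]_(D + 1), 'rV[R]_n) := linfun (mulmxr flag_mx).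

Definition flag_space : {vspace 'rV[R]_n} := limg flag_map.

Definition ucoord (u : 'rV[R]_(D + 1)) (k : nat) : R :=
  \sum_(j < D) u 0 (lshift 1 j) * (k == j :> nat)%:R.

Lemma ucoordE u (j : 'I_D) : ucoord u j = u 0 (lshift 1 j).
Proof.
rewrite /ucoord (bigD1 j) //= eqxx mulr1 big1 ?addr0 // => i neq_ij.
by rewrite [_ == _](_ : _ = false) ?mulr0 //; apply: negPf; rewrite eq_sym.
Qed.

Lemma flag_mx_x u r : (r <= l)%N ->
  (u *m flag_mx) 0 (pos r) = ucoord u (r - q)%N - u 0 (rshift D ord0) * ((q - r) * a)%:R.
Proof.
move=> le_rl; rewrite mxE big_split_ord big_ord1 /=; congr (_ + _).
  by apply: eq_bigr => j _; rewrite block_mxEul mxE inordK.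
by rewrite block_mxEdl mxE inordK // mulrN.
Qed.

Lemma flag_mx_z u : (u *m flag_mx) 0 (rshift l.+1 ord0) = u 0 (rshift D ord0).
Proof.
rewrite mxE big_split_ord big_ord1 /= block_mxEdr mxE eqxx mulr1 big1 ?add0r // => j _.
by rewrite block_mxEur mxE mulr0.
Qed.

Lemma leq_flag_col (j : 'I_D) : (q + j <= l)%N.
Proof. by have := ltn_ord j; rewrite /q; lia. Qed.

Lemma flag_mxK u : \row_j (u *m flag_mx) 0 (flag_col j) = u.
Proof.
apply/rowP => j; rewrite mxE /flag_col; case: splitP => j' def_j.
  rewrite flag_mx_x ?leq_flag_col // addKn ucoordE.
  have -> : (q - (q + j') = 0)%N by lia.
  by rewrite mul0n mulr0 subr0; congr (u 0 _); apply/val_inj.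
by rewrite flag_mx_z; congr (u 0 _); apply/val_inj; rewrite /= def_j ord1.
Qed.

Lemma flag_mapE u : flag_map u = u *m flag_mx.
Proof. by rewrite lfunE. Qed.

Lemma flag_space_memP w :
  reflect (w = (\row_j w 0 (flag_col j)) *m flag_mx) (w \in flag_space).
Proof.
apply: (iffP idP) => [/memv_imgP[u _ ->]|->].
  by rewrite flag_mapE flag_mxK.
by rewrite -flag_mapE memv_img ?memvf.
Qed.

Lemma flag_map_inj : lker flag_map = 0%VS.
Proof.
apply/eqP/lker0P => u v; rewrite !flag_mapE => eq_uv.
by rewrite -[u]flag_mxK eq_uv flag_mxK.
Qed.

Lemma dim_flag_space : \dim flag_space = (D + 1)%N.
Proof.
have := limg_dim_eq (U := fullv) (f := flag_map).
rewrite flag_map_inj capv0 => /(_ erefl) ->.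
by rewrite dimvf /dim /= mul1n.
Qed.

Definition flag_hyperplanes : affine_arrangement R l.+1 :=
  [seq (x_ R (inord i) - x_ R (inord i.+1), - a%:R) | i <- iota 0 q] ++
  (if D == 0 then [:: (2 *: x_ R (inord q), 0)] else [::]).

Lemma flag_hyperplanes_sub : {subset flag_hyperplanes <= C0 R l.+1 m a}.
Proof.
move=> h; rewrite mem_cat => /orP[/mapP[i]|].
  rewrite mem_iota => lt_iq ->; apply: C0_sub; first by rewrite /q in lt_iq; lia.
  by rewrite -[- _]add0r; apply: (@mem_int_range R a 0).
case: ifP => // _; rewrite inE => /eqP ->; apply: C0_double.
by rewrite -[0](subrr m%:R); apply: mem_int_range; lia.
Qed.

Local Notation form h := (row_mx h.1 (- h.2)%:M).

Lemma flag_space_hyperplanes w :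
  (w \in flag_space) = all (fun h => dot w (form h) == 0) flag_hyperplanes.
Proof.
pose z := w 0 (rshift l.+1 ord0).
rewrite all_cat all_map; apply/flag_space_memP/andP => [def_w|[]].
  set u := \row_j _ in def_w; rewrite def_w; split.
    apply/allP => i; rewrite mem_iota => lt_iq /=.
    rewrite dot_row_mx dotD dotN !dot_x_ !lsubmx_x flag_mx_z.
    rewrite /q in lt_iq; rewrite !flag_mx_x -/q; [|lia|lia].
    have -> : (i - q = 0)%N by rewrite /q; lia.
    have -> : (i.+1 - q = 0)%N by rewrite /q; lia.
    have -> : (q - i = (q - i.+1).+1)%N by rewrite /q; lia.
    by rewrite !natrM -natr1 opprK; apply/eqP; ring.
  case: ifP => // /eqP D0; rewrite /= andbT dot_row_mx dotZ dot_x_ lsubmx_x.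
  rewrite flag_mx_x ?leq_subr // !subnn mul0n mulr0 subr0 oppr0 mulr0 addr0.
  by rewrite /ucoord big1 ?mulr0 // => j; have := ltn_ord j; rewrite {2}D0.
move=> /allP string last0.
have def_x t : (t <= q)%N -> w 0 (pos (q - t)) = w 0 (pos q) - z * (t * a)%:R.
  elim: t => [|t IH] lt_tq; first by rewrite subn0 mul0n mulr0 subr0.
  have /string : (q - t.+1)%N \in iota 0 q by rewrite mem_iota; lia.
  rewrite /= dot_row_mx dotD dotN !dot_x_ !lsubmx_x -/z opprK subnSK // => /eqP.
  by rewrite IH 1?ltnW // !natrM -natr1 => e; apply/eqP; rewrite -subr_eq0 -e; apply/eqP; ring.
apply/rowP => i; rewrite -[i]splitK; case: (split i) => i' /=; last first.
  by rewrite ord1 flag_mx_z mxE /flag_col; case: splitP => // j /= def_j;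
     have := ltn_ord j; lia.
have le_il : (i' <= l)%N by rewrite -ltnS ltn_ord.
have -> : lshift 1 i' = pos i' by rewrite inord_val.
rewrite flag_mx_x // [X in _ - X * _]mxE.
have -> : flag_col (rshift D ord0) = rshift l.+1 ord0.
  by rewrite /flag_col; case: splitP => // j /= def_j; have := ltn_ord j; lia.
have col_j (j : 'I_D) : (\row_j w 0 (flag_col j)) 0 (lshift 1 j) = w 0 (pos (q + j)).
  rewrite mxE /flag_col; case: splitP => [j' /= def_j|j' /= def_j].
    by congr (w 0 (pos (_ + _))).
  by have := ltn_ord j; lia.
have [le_qi|lt_iq] := leqP q i'.
  have -> : (q - i' = 0)%N by lia.
  rewrite mul0n mulr0 subr0; have [D0|D_gt0] := posnP D.
    rewrite /ucoord big1 => [|j]; last by have := ltn_ord j; rewrite {2}D0.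
    have -> : (i' : nat) = q by apply/eqP; rewrite eqn_leq le_qi /q D0 subn0 le_il.
    move: last0; rewrite D0 /= andbT dot_row_mx dotZ dot_x_ lsubmx_x oppr0 mulr0 addr0.
    by rewrite mulf_eq0 pnatr_eq0 /= => /eqP.
  have lt_iD : (i' - q < D)%N by rewrite /q; lia.
  by rewrite (ucoordE _ (Ordinal lt_iD)) col_j /= subnKC.
have -> : (i' - q = 0)%N by lia.
have -> : w 0 (pos i') = w 0 (pos q) - z * ((q - i') * a)%:R.
  by rewrite -def_x ?leq_subr // subKn // ltnW.
congr (_ - _).
have [D0|D_gt0] := posnP D.
  rewrite /ucoord big1 => [|j]; last by have := ltn_ord j; rewrite {2}D0.
  move: last0; rewrite D0 /= andbT dot_row_mx dotZ dot_x_ lsubmx_x oppr0 mulr0 addr0.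
  by rewrite mulf_eq0 pnatr_eq0 /= => /eqP.
by rewrite (ucoordE _ (Ordinal D_gt0)) col_j /= addn0.
Qed.

Lemma flag_space_lattice : in_lattice (cone (C0 R l.+1 m a)) flag_space.
Proof.
exists [seq linear_hyperplane (form h) | h <- flag_hyperplanes].
  move=> _ /mapP[h h_in ->]; rewrite coneE map_f // inE; apply/orP; right.
  by apply: map_f; apply: flag_hyperplanes_sub.
apply/vspaceP => w; rewrite flag_space_hyperplanes.
elim: flag_hyperplanes => [|h hs IH]; first by rewrite big_nil memvf.
by rewrite /= big_cons memv_cap linear_hyperplaneE IH.
Qed.

End FlagStep.

Lemma nonproportional_scale (K : numFieldType) n (b c : 'rV[K]_n) :
  b != 0 -> (forall s, c != s *: b) -> nonproportional b c.
Proof.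
move=> /row_neq0P[k bk_neq0] /(_ (c 0 k / b 0 k)) neq_c.
have [j neq_cj] : exists j, c 0 j != c 0 k / b 0 k * b 0 j.
  apply/existsP; apply: contraNT neq_c => /existsPn eq_c; apply/eqP/rowP => j.
  by rewrite mxE; apply/eqP; rewrite -[_ == _]negbK eq_c.
have dot_delta i d : dot (delta_mx 0 i) d = d 0 i :> K.
  rewrite /dot (bigD1 i) //= mxE !eqxx mul1r big1 ?addr0 // => i' neq_i.
  by rewrite mxE (negPf neq_i) andbF mul0r.
exists (b 0 k *: delta_mx 0 j - b 0 j *: delta_mx 0 k).
have dotE d : dot (b 0 k *: delta_mx 0 j - b 0 j *: delta_mx 0 k) d =
    b 0 k * d 0 j - b 0 j * d 0 k.
  rewrite -[d 0 j]dot_delta -[d 0 k]dot_delta /dot !mulr_sumr -sumrB.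
  by apply: eq_bigr => i _; rewrite !mxE; ring.
split; first by rewrite dotE mulrC subrr.
rewrite dotE subr_eq0; apply: contraNneq neq_cj => eq_bc.
by rewrite mulrAC [c 0 k * _]mulrC -eq_bc [b 0 k * _]mulrC mulfK.
Qed.

Section Roots.
Variables (R : realType) (D : nat).
Implicit Types (p : 'I_D * 'I_D).

(* All roots of C_D up to sign, one for each ordered pair. *)
Definition root p : 'rV[R]_D :=
  if (p.1 < p.2)%N then x_ R p.1 - x_ R p.2 else x_ R p.1 + x_ R p.2.

Definition root_sign p : R := if (p.1 < p.2)%N then -1 else 1.

Lemma rootE p k : root p 0 k = (k == p.1)%:R + root_sign p * (k == p.2)%:R.
Proof. by rewrite /root /root_sign; case: ifP => _; rewrite !mxE; ring. Qed.

Lemma root_norm p : \sum_k `|root p 0 k| = 2.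
Proof.
rewrite (bigD1 p.1) //= rootE eqxx; have [eq_p|neq_p] := eqVneq p.1 p.2.
  rewrite /root_sign -eq_p ltnn mulr1 big1 => [|k neq_k].
    by rewrite addr0 ger0_norm ?addr_ge0 ?ler01.
  by rewrite rootE -eq_p (negPf neq_k) mulr0 addr0 normr0.
rewrite mulr0 addr0 normr1 (bigD1 p.2) ?[p.2 == _]eq_sym //= rootE eqxx.
rewrite eq_sym (negPf neq_p) add0r mulr1 big1 => [|k /andP[neq1 neq2]].
  by rewrite addr0 /root_sign; case: ifP => _; rewrite ?normrN normr1.
by rewrite rootE (negPf neq1) (negPf neq2) mulr0 addr0 normr0.
Qed.

Lemma root_gt0 p : 0 < \sum_(k < D) (D - k)%:R * root p 0 k.
Proof.
have delta (i : 'I_D) : \sum_(k < D) (D - k)%:R * (k == i)%:R = (D - i)%:R :> R.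
  rewrite (bigD1 i) //= eqxx mulr1 big1 ?addr0 // => k neq_k.
  by rewrite (negPf neq_k) mulr0.
have -> : \sum_(k < D) (D - k)%:R * root p 0 k = (D - p.1)%:R + root_sign p * (D - p.2)%:R.
  rewrite -!delta mulr_sumr -big_split; apply: eq_bigr => k _.
  by rewrite rootE /=; ring.
have lt_1 := ltn_ord p.1; have lt_2 := ltn_ord p.2.
rewrite /root_sign; case: ifP => lt_p; last by rewrite mul1r -natrD ltr0n; lia.
by rewrite mulN1r subr_gt0 ltr_nat; lia.
Qed.

Lemma root_neq0 p : root p != 0.
Proof.
apply: contraTneq (root_gt0 p) => ->.
by rewrite big1 ?ltxx // => k _; rewrite mxE mulr0.
Qed.

Lemma root_inj : injective root.
Proof.
move=> [i j] [i' j'] eq_root.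
have entry k : (k == i)%:R + root_sign (i, j) * (k == j)%:R =
    (k == i')%:R + root_sign (i', j') * (k == j')%:R :> R.
  by have := congr1 (fun r : 'rV_D => r 0 k) eq_root; rewrite !rootE.
have sign_neq0 p : root_sign p != 0.
  by rewrite /root_sign; case: ifP => _; rewrite ?oppr_eq0 oner_neq0.
have [eq_ii'|neq_ii'] := eqVneq i i'.
  congr (_, _); rewrite -?eq_ii' //; move: (entry j); rewrite -eq_ii' eqxx mulr1.
  move/addrI; have [//|_] := eqVneq j j'; rewrite mulr0 => /eqP.
  by rewrite (negPf (sign_neq0 _)).
have lt_ii' : (i < i')%N.
  rewrite ltn_neqAle val_eqE neq_ii' /= leqNgt; apply/negP => lt_i'i.
  move: (entry i); rewrite eqxx (negPf neq_ii') add0r /root_sign /=.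
  have [<-|_] := eqVneq i j'; last by have [<-|_] := eqVneq; rewrite ?ltnn /= ?mulr0; lra.
  by rewrite lt_i'i; have [<-|_] := eqVneq; rewrite ?ltnn /= ?mulr0; lra.
exfalso; move: (entry i'); rewrite eqxx [i' == i]eq_sym (negPf neq_ii') add0r /root_sign /=.
have [<-|_] := eqVneq i' j; last by have [<-|_] := eqVneq; rewrite ?ltnn /= ?mulr0; lra.
by rewrite lt_ii'; have [<-|_] := eqVneq; rewrite ?ltnn /= ?mulr0; lra.
Qed.

Lemma root_scale p p' s : root p' = s *: root p -> s = 1 /\ p' = p.
Proof.
move=> eq_root; have norm_s : `|s| = 1.
  have := root_norm p'; rewrite eq_root.
  under eq_bigr => k _ do rewrite mxE normrM.
  by rewrite -mulr_sumr root_norm => /(canRL (mulfK _)) ->; rewrite ?divff ?pnatr_eq0.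
have s_gt0 : 0 < s.
  have := root_gt0 p'; rewrite eq_root.
  under eq_bigr => k _ do rewrite mxE mulrCA.
  by rewrite -mulr_sumr pmulr_lgt0 ?root_gt0.
have s1 : s = 1 by rewrite -norm_s gtr0_norm.
by split=> //; apply: root_inj; rewrite eq_root s1 scale1r.
Qed.

Definition affine_root_forms (N : 'I_D * 'I_D -> nat) (o : 'I_D * 'I_D -> R) :
    seq 'rV[R]_(D + 1) :=
  row_mx 0 1%:M ::
  [seq row_mx (root p) (- (r%:R - o p))%:M
     | p <- enum {: 'I_D * 'I_D}, r <- iota 0 (N p)].

Lemma row_mx_scalar_inj (c c' : 'rV[R]_D) (s s' : R) :
  row_mx c s%:M = row_mx c' s'%:M -> c = c' /\ s = s'.
Proof.
case/eq_row_mx=> -> /matrixP/(_ ord0 ord0).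
by rewrite !mxE eqxx !mulr1n.
Qed.

Lemma affine_root_forms_uniq N o : uniq (affine_root_forms N o).
Proof.
rewrite /affine_root_forms /=; apply/andP; split.
  apply/allpairsPdep => -[p [r [_ _ /row_mx_scalar_inj[root0 _]]]].
  by have := root_neq0 p; rewrite -root0 eqxx.
apply: allpairs_uniq_dep => [|p _|]; rewrite ?enum_uniq ?iota_uniq //.
move=> [p r] [p' r'] _ _ /= /row_mx_scalar_inj[/root_inj <- /oppr_inj/addIr/eqP].
by rewrite eqr_nat => /eqP <-.
Qed.

Lemma affine_root_forms_neq0 N o b : b \in affine_root_forms N o -> b != 0.
Proof.
have row0 : 0 = row_mx 0 0%:M :> 'rV[R]_(D + 1) by rewrite raddf0 row_mx0.
case/predU1P=> [->|/allpairsPdep[p [r [_ _ ->]]]].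
  by apply/eqP; rewrite row0 => /row_mx_scalar_inj[_ /eqP]; rewrite oner_eq0.
apply/eqP; rewrite row0 => /row_mx_scalar_inj[/eqP].
by rewrite (negPf (root_neq0 p)).
Qed.

Lemma affine_root_forms_nonproportional N o :
  {in affine_root_forms N o &, forall b c, b != c -> nonproportional b c}.
Proof.
move=> b c b_in c_in neq_bc; apply: nonproportional_scale => [|s].
  exact: affine_root_forms_neq0 b_in.
apply: contraNneq neq_bc => eq_cb.
have scaleE (d : 'rV[R]_D) t : s *: row_mx d t%:M = row_mx (s *: d) (s * t)%:M.
  by rewrite scale_row_mx scale_scalar_mx.
move: b_in c_in eq_cb => /predU1P[->|/allpairsPdep[p [r [_ _ ->]]]];
  move=> /predU1P[->|/allpairsPdep[p' [r' [_ _ ->]]]];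
  rewrite scaleE ?scaler0 => /row_mx_scalar_inj[].
- by [].
- by move=> root0; have := root_neq0 p'; rewrite root0 eqxx.
- move=> /esym/eqP; rewrite scaler_eq0 (negPf (root_neq0 p)) orbF => /eqP ->.
  by rewrite mul0r => /eqP; rewrite oner_eq0.
by move=> /root_scale[-> ->]; rewrite mul1r => ->.
Qed.

Lemma size_affine_root_forms N o :
  size (affine_root_forms N o) = (\sum_(i < D) \sum_(j < D) N (i, j)).+1.
Proof.
rewrite /= size_allpairs_dep sumnE big_map; congr _.+1.
under eq_bigr => p _ do rewrite size_iota.
by rewrite big_enum pair_bigA; apply: eq_bigr => -[].
Qed.

End Roots.

Lemma split_multiple b T y : (y <= 2 * b + T * b)%N ->
  exists t s, [/\ (t <= T)%N, (s <= 2 * b)%N & y = (s + t * b)%N].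
Proof.
elim: T y => [|T IH] y le_y; first by exists 0%N, y; split; lia.
have [le_y2|lt_2y] := leqP y (2 * b); first by exists 0%N, y; split; lia.
have [|t [s [le_t le_s def_y]]] := IH (y - b)%N; first by lia.
by exists t.+1, s; split; lia.
Qed.

Section FlagRoots.
Variables (R : realType) (l m a D : nat).
Hypothesis le_Dl : (D <= l.+1)%N.
Let q := (l - D.-1)%N.
Implicit Types (p : 'I_D * 'I_D) (u : 'rV[R]_(D + 1)).
Local Notation form c s := (row_mx c (- s)%:M).

Definition flag_off p : nat := if p.1 == p.2 then m else a.

Definition flag_len p : nat :=
  2 * flag_off p + 1 + q * a * ((p.1 == 0 :> nat) + (p.2 == 0 :> nat)).

Definition flag_roots : seq 'rV[R]_(D + 1) :=
  affine_root_forms flag_len (fun p => (flag_off p)%:R).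

Lemma dot_form_z n (v : 'rV[R]_(n + 1)) :
  dot v (row_mx 0 1%:M) = v 0 (rshift n ord0).
Proof. by rewrite dot_row_mx dot0 add0r mulr1. Qed.

Lemma dot_form_root u p s :
  dot u (form (root R p) s) =
  ucoord u p.1 + root_sign R p * ucoord u p.2 - u 0 (rshift D ord0) * s.
Proof.
rewrite dot_row_mx mulrN !ucoordE /root /root_sign; congr (_ - _).
by case: ifP => _; rewrite dotD ?dotN !dot_x_ !mxE; ring.
Qed.

Lemma dot_flag_pair u r1 r2 (c s : R) : (r1 <= l)%N -> (r2 <= l)%N ->
  dot (u *m flag_mx R l a D)
    (form (x_ R (inord r1 : 'I_l.+1) + c *: x_ R (inord r2)) s) =
  ucoord u (r1 - q) + c * ucoord u (r2 - q) -
  u 0 (rshift D ord0) * (((q - r1) * a)%:R + c * ((q - r2) * a)%:R + s).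
Proof.
move=> le1 le2; rewrite dot_row_mx flag_mx_z dotD dotZ !dot_x_ !lsubmx_x.
by rewrite !flag_mx_x // -/q; ring.
Qed.

Lemma flag_roots_pullback b : b \in flag_roots ->
  exists2 c, c \in cone_forms (C0 R l.+1 m a) &
    forall u, dot (u *m flag_mx R l a D) c = dot u b.
Proof.
case/predU1P => [->|/allpairsPdep[[i j] [r [_ lt_r ->]]]].
  exists (row_mx 0 1%:M); first exact: mem_head.
  by move=> u; rewrite !dot_form_z flag_mx_z.
have le_qi := leq_flag_col le_Dl i; have le_qj := leq_flag_col le_Dl j.
rewrite -/q in le_qi le_qj.
have in_cone c s : (c, s) \in C0 R l.+1 m a ->
    form c s \in cone_forms (C0 R l.+1 m a).
  by move=> cs_in; rewrite inE; apply/orP; right; apply/mapP; exists (c, s).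
move: lt_r; rewrite mem_iota /flag_len /flag_off /= -val_eqE.
have [lt_ij|lt_ji|eq_ij] := ltngtP (i : nat) j => lt_r.
- have [|t [s [le_t le_s def_r]]] := @split_multiple a (q * (i == 0 :> nat)) r.
    by have := lt_r; case: (j : nat) lt_ij => // j' _; case: (i : nat) => [|i'] /=; lia.
  pose r1 := (q + i - t)%N.
  have [r1_i r1_t lt_r1] : [/\ (r1 - q)%N = i, (q - r1)%N = t & (r1 < q + j)%N].
    by rewrite /r1; case: (i : nat) lt_ij le_t => [|i'] /=; split; lia.
  exists (form (x_ R (inord r1 : 'I_l.+1) + (-1) *: x_ R (inord (q + j))) (s%:R - a%:R)).
    apply: in_cone; rewrite scaleN1r; apply: C0_sub => //; first by lia.
    exact: mem_int_range.
  move=> u; rewrite dot_flag_pair; [|lia|lia].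
  rewrite r1_i r1_t addKn dot_form_root /root_sign /= lt_ij.
  have -> : (q - (q + j) = 0)%N by lia.
  by rewrite def_r natrD; ring.
- have [|t [s [le_t le_s def_r]]] := @split_multiple a (q * (j == 0 :> nat)) r.
    by have := lt_r; case: (i : nat) lt_ji => // j' _; case: (j : nat) => [|i'] /=; lia.
  pose r1 := (q + j - t)%N.
  have [r1_j r1_t lt_r1] : [/\ (r1 - q)%N = j, (q - r1)%N = t & (r1 < q + i)%N].
    by rewrite /r1; case: (j : nat) lt_ji le_t => [|i'] /=; split; lia.
  exists (form (x_ R (inord r1 : 'I_l.+1) + 1 *: x_ R (inord (q + i))) (s%:R - a%:R)).
    apply: in_cone; rewrite scale1r; apply: C0_add => //; first by lia.
    exact: mem_int_range.
  move=> u; rewrite dot_flag_pair; [|lia|lia].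
  rewrite r1_j r1_t addKn dot_form_root /root_sign /= ltnNge ltnW //=.
  have -> : (q - (q + i) = 0)%N by lia.
  by rewrite def_r natrD; ring.
have double r1 (s : R) u : (r1 <= l)%N ->
    dot (u *m flag_mx R l a D) (form (2 *: x_ R (inord r1 : 'I_l.+1)) s) =
    2 * ucoord u (r1 - q) - u 0 (rshift D ord0) * (2 * ((q - r1) * a)%:R + s).
  move=> le_r1; have -> : 2 *: x_ R (inord r1 : 'I_l.+1) =
      x_ R (inord r1 : 'I_l.+1) + 1 *: x_ R (inord r1).
    by rewrite scale1r scaler_nat mulr2n.
  by rewrite dot_flag_pair //; ring.
have sign1 : root_sign R (i, j) = 1 by rewrite /root_sign /= eq_ij ltnn.
have [r_small|r_big] := leqP r (2 * m).
  exists (form (2 *: x_ R (inord (q + i) : 'I_l.+1)) (r%:R - m%:R)).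
    by apply: in_cone; apply: C0_double; apply: mem_int_range.
  move=> u; rewrite double // addKn dot_form_root sign1 /= -eq_ij.
  have -> : (q - (q + i) = 0)%N by lia.
  by ring.
have i0 : (i : nat) = 0%N by move: lt_r r_big; rewrite -eq_ij; case: (i : nat) => // i'; lia.
have lt_r' : (r <= 2 * m + 2 * q * a)%N by move: lt_r; rewrite -eq_ij i0; lia.
have [r_big'|r_mid] := leqP (2 * q * a) r.
  exists (form (2 *: x_ R (inord 0 : 'I_l.+1)) ((r - 2 * q * a)%:R - m%:R)).
    by apply: in_cone; apply: C0_double; apply: (@mem_int_range R m (r - 2 * q * a));
      rewrite leq_subLR addnC.
  move=> u; rewrite double // sub0n subn0 dot_form_root sign1 /= -eq_ij i0.
  by rewrite natrB //; ring.
have q_gt0 : (0 < q)%N by case: (q) r_mid => //; lia.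
have [|t [s [le_t le_s def_r]]] := @split_multiple a (2 * q - 2) (r - m).
  have -> : (2 * a + (2 * q - 2) * a = 2 * q * a)%N.
    by rewrite -mulnDl; congr (_ * _)%N; lia.
  by lia.
pose t1 := minn t.+1 q; pose t2 := (t.+1 - t1)%N.
exists (form (x_ R (inord (q - t1) : 'I_l.+1) + 1 *: x_ R (inord (q - t2)))
             (s%:R - a%:R)).
  apply: in_cone; rewrite scale1r; apply: C0_add; last exact: mem_int_range.
  by rewrite /t2 /t1 /q; lia.
move=> u; rewrite dot_flag_pair; [|by rewrite /q; lia|by rewrite /q; lia].
have -> : (q - t1 - q = 0)%N by lia.
have -> : (q - t2 - q = 0)%N by lia.
have -> : (q - (q - t1) = t1)%N by rewrite /t1; lia.
have -> : (q - (q - t2) = t2)%N by rewrite /t2 /t1; lia.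
rewrite dot_form_root sign1 /= -eq_ij i0; congr (_ - _ * _).
rewrite mul1r addrA -natrD -mulnDl subnKC; last by rewrite /t1; lia.
have -> : r = (s + t * a + m)%N by lia.
by ring.
Qed.

Definition flag_exponents : seq nat :=
  1%N :: [seq (2 * (a * l + m + k) + 1)%N | k <- iota 0 D].

Lemma size_flag_roots : size flag_roots = sumn flag_exponents.
Proof.
rewrite size_affine_root_forms /= sumnE big_map -[in RHS](subn0 D).
rewrite -/(index_iota 0 D) big_mkord; congr _.+1.
have [D0|D_gt0] := posnP D.
  by rewrite !big1 // => i; have := ltn_ord i; rewrite {2}D0.
have sum_eq0 : (\sum_(i < D) (i == 0 :> nat) = 1)%N.
  rewrite (bigD1 (Ordinal D_gt0)) //= big1 // => i.
  by rewrite -val_eqE /= => /negPf ->.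
have sum_off i : (\sum_(j < D) flag_off (i, j) = m + D.-1 * a)%N.
  rewrite (bigD1 i) //= /flag_off /= eqxx; congr (_ + _)%N.
  rewrite (eq_bigr (fun=> a)) => [|j neq_ji]; last by rewrite eq_sym (negPf neq_ji).
  rewrite sum_nat_const; congr (_ * a)%N.
  by rewrite -[in RHS](card_ord D) -(cardC1 i); apply: eq_card.
have sum_len i : (\sum_(j < D) flag_len (i, j) =
    2 * (m + D.-1 * a) + D + q * a * (D * (i == 0 :> nat) + 1))%N.
  rewrite /flag_len 2!big_split /= -!big_distrr /= sum_off big_split /= sum_eq0.
  by rewrite !sum_nat_const card_ord muln1.
rewrite (eq_bigr (fun i : 'I_D =>
    (2 * (m + D.-1 * a) + D + q * a) + q * a * D * (i == 0 :> nat))%N); last first.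
  by move=> i _; rewrite sum_len (mulnDr (q * a)) muln1 mulnA [in LHS]addnC; lia.
rewrite big_split /= sum_nat_const card_ord -big_distrr /= sum_eq0 muln1.
have sum_id : (2 * (\sum_(i < D) i) = D * D.-1)%N.
  rewrite -(big_mkord xpredT id) bin2_sum bin2 mul2n halfK.
  by case: (D) => // d; rewrite oddM /= andNb subn0.
have -> : (\sum_(i < D) (2 * (a * l + m + i) + 1) =
    D * (2 * (a * l + m) + 1) + D * D.-1)%N.
  rewrite (eq_bigr (fun i : 'I_D => 2 * (a * l + m) + 1 + 2 * i)%N) => [|i _]; last by lia.
  by rewrite big_split /= sum_nat_const card_ord -big_distrr /= sum_id.
rewrite /q.
case: (D) le_Dl D_gt0 => // d /=; rewrite ltnS => le_dl _.
have -> : (a * l = a * (l - d) + a * d)%N by rewrite -mulnDr subnK.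
by nia.
Qed.

End FlagRoots.

Lemma comp_mpoly_homog (K : realType) n k (lq : n.-tuple {mpoly K[k]}) e
    (p : {mpoly K[n]}) :
  p \is e.-homog -> (forall i, tnth lq i \is 1.-homog) -> p \mPo lq \is e.-homog.
Proof.
move=> /dhomogP p_homog lq_homog; rewrite comp_mpolyE big_seq.
apply: rpred_sum => mm mm_in; rewrite rpredZ // -(p_homog mm mm_in) /= mdegE.
apply: dhomog_bigprod => i; rewrite -[X in X.-homog]mul1n.
exact: dhomogMn.
Qed.

Lemma big_ord_addn1 (V : nmodType) D (F : nat -> V) :
  \sum_(k < D + 1) F k = F 0 + \sum_(k < D) F k.+1.
Proof. by rewrite addn1 big_ord_recl. Qed.

Section FlagFields.
Variables (R : realType) (l m a D : nat).
Hypothesis le_Dl : (D <= l.+1)%N.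
Local Notation M := (flag_mx R l a D).
Local Notation X := (flag_space R l a D).
Local Notation A := (cone (C0 R l.+1 m a)).

Definition flag_coords : (l.+1 + 1).-tuple {mpoly R[D + 1]} :=
  [tuple lin (\row_r M r i) | i < l.+1 + 1].

Definition flag_field k (j : 'I_(D + 1)) : {mpoly R[D + 1]} :=
  cone_field R m a k (flag_col l j) \mPo flag_coords.

Lemma flag_field_eval k j (v : 'rV[R]_(D + 1)) :
  (flag_field k j).@[v 0] = (cone_field R m a k (flag_col l j)).@[(v *m M) 0].
Proof.
rewrite comp_mpoly_meval; apply: meval_eq => i; rewrite tnth_mktuple lin_eval mxE.
by apply: eq_bigr => r _; rewrite mxE.
Qed.

Lemma flag_field_homog k j :
  flag_field k j \is (if k is k'.+1 then 2 * (a * l + m + k') + 1 else 1)%N.-homog.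
Proof.
apply: comp_mpoly_homog => [|i]; first exact: cone_field_homog.
by rewrite tnth_mktuple lin_homog.
Qed.

Lemma flag_field_tangent k (H : {vspace 'rV[R]_(D + 1)}) (v : 'rV[R]_(D + 1)) :
  H \in [seq (flag_map R l a D @^-1: K)%VS | K <- restriction A X] -> v \in H ->
  \row_j (flag_field k j).@[v 0] \in H.
Proof.
case/mapP=> _ /mapP[H' H'_in ->] ->.
move: H'_in; rewrite mem_filter => /andP[_]; rewrite coneE => /mapP[b b_in ->].
rewrite -!memv_preim !memv_cap !linear_hyperplaneE !flag_mapE => /andP[/eqP vb vX].
set w := v *m M in vb vX; pose y := \row_i (cone_field R m a k i).@[w 0].
have yX : y \in X.
  rewrite flag_space_hyperplanes //; apply/allP => h h_in.
  have hC := flag_hyperplanes_sub m le_Dl h_in.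
  apply/eqP/cone_field_tangent.
    by rewrite inE; apply/orP; right; apply/mapP; exists h.
  by move: vX; rewrite flag_space_hyperplanes // => /allP/(_ h h_in)/eqP.
have -> : \row_j (flag_field k j).@[v 0] = \row_j y 0 (flag_col l j).
  by apply/rowP => j; rewrite !mxE flag_field_eval.
rewrite -(flag_space_memP a le_Dl y yX) yX andbT.
by apply/eqP/cone_field_tangent.
Qed.

End FlagFields.

Lemma shifted_squares_h0 (S : comNzRingType) a (y : S) :
  shifted_squares a 0 y = nseq a (y ^+ 2).
Proof.
rewrite /shifted_squares /snodes -[a in RHS](size_iota 0) mulr0 addr0.
by elim: (iota 0 a) => //= r s ->; rewrite /snode mulr0 addr0.
Qed.

Lemma central_minor_neq0 (R : realType) l m a D : (D <= l.+1)%N ->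
  \det (\matrix_(k < D, j < D) flag_field R l m a k.+1 (lshift 1 j)) != 0.
Proof.
case: D => [|D] le_Dl; first by rewrite det_mx00 oner_neq0.
pose q := (l - D)%N.
have [|u det_neq0] := @central_mx_exists_mult R a D (q.+1 * a) m.
  by rewrite mulSn leq_addr.
pose v0 : 'rV[R]_(D.+1 + 1) := row_mx (\row_j u j) 0.
apply: contraNneq det_neq0 => detN0.
have := congr1 (meval (v0 0)) detN0; rewrite meval0 -det_map_mx -det_tr => <-.
apply/eqP; congr (\det _); apply/matrixP => j k; rewrite !mxE.
transitivity (flag_field R l m a k.+1 (lshift 1 j)).@[v0 0]; last by [].
rewrite flag_field_eval.
set w := v0 *m _.
have w_x r : (r <= l)%N -> w 0 (lshift 1 (inord r : 'I_l.+1)) = u (r - q)%N.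
  move=> le_rl; rewrite /w flag_mx_x // row_mxEr mxE mul0r subr0.
  have lt_r : (r - q < D.+1)%N by rewrite /q; lia.
  by rewrite (ucoordE _ (Ordinal lt_r)) row_mxEl mxE.
have col_j : flag_col l (lshift 1 j) = lshift 1 (inord (q + j) : 'I_l.+1).
  rewrite /flag_col; case: splitP => j' /= def_j; first by rewrite def_j.
  by have := ltn_ord j; lia.
have le_qj : (q + j <= l)%N by have := ltn_ord j; rewrite /q; lia.
have := cone_field_eval m a k w => /rowP/(_ (lshift 1 (inord (q + j)))).
rewrite col_j mxE => ->; rewrite row_mxEl mxE w_x // addKn.
rewrite /w flag_mx_z row_mxEr mxE mulr0 -/w.
rewrite /field_value antidiff_h0 /squares.
have -> : central_squares a 0 (m + k) = nseq (m + k) 0 :> seq R.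
  rewrite /central_squares (eq_map (g := fun=> 0)) => [|r]; last by rewrite /= mulr0 expr0n.
  by rewrite -[in RHS](size_iota 0 (m + k)); elim: (iota _ _) => //= r s ->.
rewrite central_form_nseq0 add0n; congr (central_form _ _ _ _ _).
rewrite (eq_map (g := (fun r => nseq a (u (r - q)%N ^+ 2)) \o val)) => [|i]; last first.
  have w_i : w 0 (lshift 1 i) = u (i - q)%N.
    by rewrite -[in LHS](inord_val i); apply: w_x; rewrite -ltnS.
  by rewrite w_i shifted_squares_h0.
rewrite map_comp val_enum_ord.
have -> : iota 0 l.+1 = iota 0 q.+1 ++ iota q.+1 D.
  by rewrite -iotaD; congr (iota _ _); rewrite /q; lia.
rewrite map_cat flatten_cat; congr (_ ++ _).
  rewrite (@eq_in_map _ _ _ (fun=> nseq a (u 0%N ^+ 2)) _).1 => [|r]; last first.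
    by rewrite mem_iota => lt_r; congr (nseq a (u _ ^+ 2)); lia.
  rewrite -[q.+1 in LHS](size_iota 0).
  by elim: (iota 0 q.+1) => //= _ s IH; rewrite mulSn nseqD IH.
rewrite /doubled_squares -[q.+1]addn0 iotaDl -map_comp; congr flatten.
apply: eq_map => r /=; congr (nseq a (u _ ^+ 2)).
by rewrite addSn subSn ?leq_addr // addKn.
Qed.

Lemma flag_det_neq0 (R : realType) l m a D : (D <= l.+1)%N ->
  \det (\matrix_(k < D + 1, j < D + 1) flag_field R l m a k j) != 0.
Proof.
move=> le_Dl; set N := (\matrix_(k, j) _)%R.
have Z_neq0 : ('X_(rshift D ord0) : {mpoly R[D + 1]}) != 0.
  by apply/eqP => /(congr1 (mcoeff U_(rshift D ord0)));
     rewrite mcoeffX eqxx mcoeff0 => /eqP; rewrite oner_eq0.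
have [v] := mpoly_nonroot (mulf_neq0 Z_neq0 (central_minor_neq0 R m a le_Dl)).
rewrite mevalM mevalXU mulf_eq0 => /norP[z_neq0 detv_neq0].
apply: contraNneq detv_neq0 => detN0.
pose V := \row_i v i.
have vV i : v i = V 0 i by rewrite mxE.
have : \det (map_mx (meval v) N) == 0 by rewrite det_map_mx detN0 rmorph0.
case/det0P => w w_neq0 wN0.
pose wn k := if insub k is Some i then w 0 (i : 'I_(D + 1)) else 0.
have wnE (k : 'I_(D + 1)) : w 0 k = wn k by rewrite /wn valK.
have sum0 j : wn 0%N * (flag_field R l m a 0 j).@[v] +
    \sum_(k < D) wn k.+1 * (flag_field R l m a k.+1 j).@[v] = 0.
  rewrite -(big_ord_addn1 D (fun k => wn k * (flag_field R l m a k j).@[v])).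
  have /rowP/(_ j) := wN0; rewrite mxE [in RHS]mxE => wN0j; rewrite -[RHS]wN0j.
  by apply: eq_bigr => k _; rewrite wnE !mxE.
have col_z : flag_col l (rshift D ord0) = rshift l.+1 ord0.
  by rewrite /flag_col; case: splitP => // j /= def_j; have := ltn_ord j; lia.
have wn0 : wn 0%N = 0.
  have := sum0 (rshift D ord0); rewrite big1 ?addr0 => [|k _].
    rewrite (meval_eq _ vV) flag_field_eval col_z /= mevalXU flag_mx_z -vV.
    by move/eqP; rewrite mulf_eq0 (negPf z_neq0) orbF => /eqP.
  rewrite (meval_eq _ vV) flag_field_eval col_z /=.
  by case: splitP => [j /= def_j|_ _]; [have := ltn_ord j; lia | rewrite meval0 mulr0].
rewrite -det_map_mx; apply/det0P; exists (\row_k wn k.+1).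
  apply: contraNneq w_neq0 => wn0'; apply/eqP/rowP => k; rewrite wnE mxE.
  case: (k : nat) (ltn_ord k) => // k'; rewrite addn1 ltnS => lt_k'.
  by have /rowP/(_ (Ordinal lt_k')) := wn0'; rewrite !mxE.
apply/rowP => j; have := sum0 (lshift 1 j); rewrite wn0 mul0r add0r => sum0j.
rewrite mxE [in RHS]mxE -[RHS]sum0j.
by apply: eq_bigr => k _; rewrite !mxE.
Qed.

Lemma flag_free (R : realType) l m a D : (D <= l.+1)%N ->
  free_with_exponents
    [seq (flag_map R l a D @^-1: K)%VS
       | K <- restriction (cone (C0 R l.+1 m a)) (flag_space R l a D)]
    (flag_exponents l m a D).
Proof.
move=> le_Dl; apply: (@saito_criterion _ _ _ _
  (\matrix_(k, j) flag_field R l m a k j) (flag_roots R l m a D)).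
- by rewrite /= size_map size_iota addn1.
- move=> k j; rewrite mxE.
  have -> : nth 0%N (flag_exponents l m a D) k =
      (if k : nat is k'.+1 then 2 * (a * l + m + k') + 1 else 1)%N.
    case: (k : nat) (ltn_ord k) => //= k'; rewrite addn1 ltnS => lt_k'.
    by rewrite (nth_map 0%N) ?size_iota // nth_iota.
  exact: flag_field_homog.
- move=> k H v H_in vH; have := flag_field_tangent le_Dl k H_in vH.
  suff -> : \row_j (flag_field R l m a k j).@[v 0] =
      \row_j ((\matrix_(k, j) flag_field R l m a k j) k j).@[v 0] by [].
  by apply/rowP => j; rewrite !mxE.
- move=> b b_in; have b_neq0 := affine_root_forms_neq0 b_in; split=> //.
  have [c c_in cP] := flag_roots_pullback le_Dl b_in.
  have [k bk_neq0] := row_neq0P b_neq0.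
  apply/mapP; exists (linear_hyperplane c :&: flag_space R l a D)%VS.
    apply: map_f; rewrite mem_filter coneE map_f // andbT.
    apply/subvP => /(_ (flag_map R l a D (delta_mx 0 k))).
    rewrite memv_img ?memvf // linear_hyperplaneE flag_mapE cP => /(_ isT).
    rewrite /dot (bigD1 k) //= mxE !eqxx mul1r big1 ?addr0 ?(negPf bk_neq0) //.
    by move=> j neq_jk; rewrite mxE (negPf neq_jk) andbF mul0r.
  apply/vspaceP => v; rewrite -memv_preim memv_cap !linear_hyperplaneE flag_mapE cP.
  by rewrite -flag_mapE memv_img ?memvf ?andbT.
- exact: affine_root_forms_uniq.
- exact: affine_root_forms_nonproportional.
- exact: size_flag_roots.
exact: flag_det_neq0.
Qed.

(** * Flag-accuracy *)

Lemma eq_free_with_exponents (R : realType) n (A A' : arrangement R n) e :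
  A =i A' -> free_with_exponents A e -> free_with_exponents A' e.
Proof.
move=> eqA; have eq_log theta : log_derivation A theta <-> log_derivation A' theta.
  split=> -[der log]; split=> // H alpha H_in; apply: log.
    by rewrite eqA.
  by rewrite -eqA.
case=> theta [theta_log theta_homog theta_basis]; exists theta; split=> //.
  by move=> i; apply/eq_log.
by move=> eta /eq_log; apply: theta_basis.
Qed.

Section ArrangementExtensionality.
Variables (R : realType) (n : nat).
Implicit Types (A : arrangement R n) (e : seq nat).

Lemma eq_restriction A A' X : A =i A' -> restriction A X =i restriction A' X.
Proof. by move=> eqA; apply: eq_mem_map => H; rewrite !mem_filter eqA. Qed.

Lemma eq_flag_accurate A A' e :
  A =i A' -> flag_accurate_with_exponents A e -> flag_accurate_with_exponents A' e.
Proof.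
move=> eqA [size_e sorted_e free_e [X [X_lattice X_flag X_n X_free]]].
split=> //; first exact: eq_free_with_exponents eqA free_e.
exists X; split=> // d d_n.
  have [[B B_A X_B] dim_X] := X_lattice d d_n.
  by split=> //; exists B => // H /B_A; rewrite eqA.
have [f [f_inj f_im f_free]] := X_free d d_n; exists f; split=> //.
apply: (eq_free_with_exponents _ f_free); apply: eq_mem_map.
exact: eq_restriction.
Qed.

Lemma free_with_exponents_in_coords d (X : {vspace 'rV[R]_n})
    (f : 'Hom('rV[R]_d, 'rV[R]_n)) A e :
  \dim X = d -> lker f = 0%VS -> limg f = X ->
  free_with_exponents [seq (f @^-1: K)%VS | K <- A] e ->
  free_with_exponents_in X A e.
Proof. by move=> dim_X; subst d => f_inj f_im f_free; exists f. Qed.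

End ArrangementExtensionality.

Section ConeC0.
Variables (R : realType) (l m a : nat).

Lemma C0_form_neq0 h : h \in C0 R l m a -> h.1 != 0.
Proof.
rewrite !mem_cat => /or3P[] /allpairsP[[p s] /= [p_in _ ->]] /=.
- move: p_in; rewrite mem_filter => /andP[lt_p _].
  by have := root_neq0 R (p.2, p.1); rewrite /root /= ltnNge ltnW //= addrC.
- by move: p_in; rewrite mem_filter => /andP[lt_p _]; have := root_neq0 R p; rewrite /root lt_p.
by have := root_neq0 R (p, p); rewrite /root /= ltnn -mulr2n scaler_nat.
Qed.

Lemma cone_C0_proper H : H \in cone (C0 R l m a) -> ~~ (fullv <= H)%VS.
Proof.
rewrite coneE => /mapP[b b_in ->].
have [k bk_neq0] : exists k, b 0 k != 0.
  apply/row_neq0P; case/predU1P: b_in => [->|/mapP[h h_in ->]].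
    by rewrite row_mx_eq0 negb_and orbC -scalemx1 scaler_eq0 oner_eq0 matrix_nonzero1.
  by rewrite row_mx_eq0 negb_and C0_form_neq0.
apply/subvP => /(_ (delta_mx 0 k) (memvf _)); rewrite linear_hyperplaneE.
rewrite /dot (bigD1 k) //= mxE !eqxx mul1r big1 ?addr0 ?(negPf bk_neq0) //.
by move=> j neq_jk; rewrite mxE (negPf neq_jk) andbF mul0r.
Qed.

End ConeC0.

Section FlagAccuracy.
Variables (R : realType) (l m a : nat).
Local Notation X := (fun d => flag_space R l a d.-1).

Lemma flag_map_id u : flag_map R l a l.+1 u = u.
Proof.
rewrite flag_mapE -[RHS](@flag_mxK R l a _ (leqnn _)); apply/rowP => j.
rewrite [in RHS]mxE; congr ((_ *m _) 0 _); apply/val_inj.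
rewrite /flag_col; case: splitP => j' def_j /=; last by rewrite def_j ord1.
by rewrite subnn add0n inordK.
Qed.

Lemma flag_space_full : flag_space R l a l.+1 = fullv.
Proof.
by apply/vspaceP => u; rewrite memvf -[u]flag_map_id memv_img ?memvf.
Qed.

Lemma flag_space_le D : (D <= l)%N -> (flag_space R l a D <= flag_space R l a D.+1)%VS.
Proof.
move=> le_Dl; apply/subvP => w; rewrite !flag_space_hyperplanes ?ltnS 1?leqW //.
move=> /allP w_h; apply/allP => h; rewrite mem_cat orbF => /mapP[i].
rewrite mem_iota => lt_i ->; apply: w_h; rewrite mem_cat map_f // mem_iota.
by move: lt_i => /=; lia.
Qed.

Lemma cone_C0_free :
  free_with_exponents (cone (C0 R l.+1 m a)) (flag_exponents l m a l.+1).
Proof.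
apply: (eq_free_with_exponents _ (flag_free R m a (leqnn l.+1))) => H.
have preim_id K : (flag_map R l a l.+1 @^-1: (K :&: fullv))%VS = K.
  by apply/vspaceP => u; rewrite -memv_preim flag_map_id capvf.
rewrite /restriction flag_space_full -map_comp.
apply/mapP/idP => [[K K_in ->]|H_in].
  by move: K_in; rewrite mem_filter /= preim_id => /andP[].
by exists H; [rewrite mem_filter H_in andbT (cone_C0_proper H_in) | rewrite /= preim_id].
Qed.

Lemma flag_exponents_sorted D : sorted leq (flag_exponents l m a D).
Proof.
rewrite /= path_sortedE ?all_map; last exact: leq_trans.
apply/andP; split; first by apply/allP => k _ /=; rewrite addn1.
rewrite sorted_map; apply: sub_sorted (iota_sorted 0 D) => i j /=.
by rewrite leq_add2r leq_mul2l leq_add2l.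
Qed.

Theorem cone_C0_flag_accurate :
  flag_accurate_with_exponents (cone (C0 R l.+1 m a)) (flag_exponents l m a l.+1).
Proof.
split; [by rewrite /= size_map size_iota addn1 | exact: flag_exponents_sorted
       | exact: cone_C0_free |].
exists X; split.
- case=> // D /= le_D; rewrite addn1 ltnS in le_D.
  by split; [apply: flag_space_lattice | rewrite dim_flag_space ?addn1].
- by case=> // D /= le_D; apply: flag_space_le; rewrite addn1 !ltnS in le_D.
- have -> : (l.+1 + 1).-1%N = l.+1 by rewrite addn1.
  exact: flag_space_full.
case=> // D /= le_D; rewrite addn1 ltnS in le_D.
apply: (free_with_exponents_in_coords (f := flag_map R l a D)) => //.
- exact: dim_flag_space.
- exact: flag_map_inj.
suff -> : (1 :: take D [seq (2 * (a * l + m + k) + 1)%N | k <- iota 0 l.+1])%N =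
    flag_exponents l m a D by apply: flag_free.
by rewrite -map_take take_iota (minn_idPl le_D).
Qed.

End FlagAccuracy.

Lemma mem_CatC (R : realType) l m : CatC R l m =i C0 R l m m.
Proof. by move=> h; rewrite /CatC /posroots_C !allpairs_cat 3!allpairs_mapl. Qed.

Local Close Scope ring_scope.

Theorem theorem5p13 (R : realType) (l m a : nat) (hl : 1 <= l) :
  flag_accurate (cone (C0 R l m a)) /\
  CatC R l m =i C0 R l m m /\
  flag_accurate_with_exponents (cone (CatC R l m))
    (1 :: [seq 2 * m * l + 2 * i - 1 | i <- iota 1 l]).
Proof.
case: l hl => // l _; split; first by eexists; apply: cone_C0_flag_accurate.
split; first exact: mem_CatC.
apply: (@eq_flag_accurate _ _ (cone (C0 R l.+1 m m))).
  move=> H; rewrite /cone !inE; congr (_ || _).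
  by apply: eq_mem_map => h; rewrite mem_CatC.
have -> : 1 :: [seq 2 * m * l.+1 + 2 * i - 1 | i <- iota 1 l.+1] =
    flag_exponents l m m l.+1.
  rewrite /flag_exponents (iotaDl 1 0) -map_comp; congr (_ :: _).
  by apply: eq_map => k /=; lia.
exact: cone_C0_flag_accurate.
Qed.
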